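(* Let $a$ be an integer and, for integers $m,n\ge 0$, put $$A_{mn}(q;a)=(-1)^n q^{\frac{(m-n)(m+n+1)(2a+1)}{4}}\frac{1}{[m+n+1]\,[m]!\,[n]!}.$$ Then $$\sum_{\mu} W^{(a,0,0)}_{\mu,\emptyset,\emptyset}(q)\,|\mu\rangle=\exp\Big(\sum_{m,n=0}^{\infty}A_{mn}(q;a)\,\psi_{m+\frac12}\psi^*_{-n-\frac12}\Big)|0\rangle ,$$ where the sum on the left is over all partitions $\mu$ (including the empty one). Equivalently, for every partition $\mu$, the coefficient of $|\mu\rangle$ on the right-hand side equals the framed one-legged topological vertex $W^{(a,0,0)}_{\mu,\emptyset,\emptyset}(q)$.
   Context: **Scalars.** $q$ is an indeterminate and scalars lie in $\mathbb{C}(q^{1/12})$. $[n]=q^{n/2}-q^{-n/2}$, $[n]!=[1][2]\cdots[n]$, $[0]!=1$. **Partitions.** For a partition $\mu=(\mu_1\ge\dots\ge\mu_l>0)$, $|\mu|=\sum_i\mu_i$, $\kappa_\mu=\sum_{i=1}^l\mu_i(\mu_i-2i+1)$, and $\mu^t$ is the conjugate partition. $\emptyset$ is the empty partition. **Symmetric functions.** $s_{\mu/\nu}$ are skew Schur functions and $c^{\mu}_{\nu\lambda}$ the Littlewood–Richardson coefficients ($s_\nu s_\lambda=\sum_\mu c^\mu_{\nu\lambda}s_\mu$). For a symmetric function $f$, $f(q^{\rho})$ is the specialization at $q^\rho=(q^{-1/2},q^{-3/2},\dots)$, i.e. the power sums are sent to $p_n\mapsto 1/[n]$; $f(q^{-\rho})$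 is the specialization at $(q^{1/2},q^{3/2},\dots)$, i.e. $p_n\mapsto -1/[n]$. **Topological vertex.** For partitions $\mu,\nu$, $$W_{\mu,\nu}(q)=(-1)^{|\mu|+|\nu|}q^{(\kappa_\mu+\kappa_\nu)/2}\sum_\eta s_{\mu/\eta}(q^{-\rho})s_{\nu/\eta}(q^{-\rho}).$$ For partitions $\mu^1,\mu^2,\mu^3$, $$W_{\mu^1,\mu^2,\mu^3}(q)=\sum_{\lambda,\tau}\Big(\sum_\eta c^{\mu^1}_{\eta\lambda}c^{(\mu^3)^t}_{\eta\tau^t}\Big)q^{\kappa_{\mu^2}/2+\kappa_{\mu^3}/2}\,\frac{W_{(\mu^2)^t,\lambda}(q)\,W_{\mu^2,\tau^t}(q)}{W_{\mu^2,\emptyset}(q)},$$ and the framed topological vertex in framing $(a_1,a_2,a_3)$ is $W^{(a_1,a_2,a_3)}_{\mu^1,\mu^2,\mu^3}(q)=q^{(a_1\kappa_{\mu^1}+a_2\kappa_{\mu^2}+a_3\kappa_{\mu^3})/2}\,W_{\mu^1,\mu^2,\mu^3}(q)$. **Fermionic Fock space.** A set $A=\{a_1>a_2>\cdots\}\subset\mathbb{Z}+\frac12$ is admissible if both $A\setminus\{r<0\}$ and $\{r\in\mathbb{Z}+\frac12: r<0\}\setminus A$ are finite. $\mathcal{F}$ is the vector space with basis the semi-infinite wedges $\underline A=\underline{a_1}\wedge\underline{a_2}\wedge\cdots$, $A$ admissible. For $r\in\mathbb{Z}+\frac12$: $\psi_r\underline A=(-1)^k\,\underline{a_1}\wedge\cdots\wedge\underline{a_k}\wedge\underline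 r\wedge\underline{a_{k+1}}\wedge\cdots$ if $r\notin A$ and exactly $k\ge 0$ elements of $A$ exceed $r$, and $\psi_r\underline A=0$ if $r\in A$; $\psi_r^*\underline A=(-1)^{k+1}\underline{a_1}\wedge\cdots\wedge\widehat{\underline{a_k}}\wedge\cdots$ if $a_k=r$, and $\psi_r^*\underline A=0$ if $r\notin A$. For a partition $\mu$ (padded by zeros), $|\mu\rangle=\underline{A_\mu}$ with $A_\mu=\{\mu_i-i+\frac12: i\ge1\}$; $|0\rangle=|\emptyset\rangle$. Infinite sums of basis vectors are formal; equality means equality of all coefficients (each coefficient of the right-hand side is a finite sum). *)

(* Defs.v *)
From HB Require Import structures.
From mathcomp Require Import all_boot all_order all_algebra finmap.
From mathcomp Require Import complex fraction mpoly.
From mathcomp Require Import boolp classical_sets cardinality fsbigop reals.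

Set Implicit Arguments.
Unset Strict Implicit.
Unset Printing Implicit Defensive.

Import Order.TTheory GRing.Theory Num.Theory.

Local Open Scope classical_set_scope.
Local Open Scope ring_scope.

(* Sums [\sum_(i \in [set: T]) F i] over an infinite type T are sums over the
   support of F.  Their value is 0 when that support is infinite, which never
   happens for the sums that occur in W3 and in the Fock space operators applied
   to the vacuum. *)

Definition is_part (s : seq nat) := sorted geq s && (0%N \notin s).

Record part := Part { part_val :> seq nat; partP : is_part part_val }.

HB.instance Definition _ := [isSub for part_val].
HB.instance Definition _ := [Choice of part by <:].

Definition part0 : part := @Part [::] isT.

Definition part_size (mu : part) : nat := sumn mu.

(* [nth 0 mu i] is mu_(i+1), which accounts for the shift of index. *)
Definition kappa (mu : part) : int :=
  \sum_(i < size mu)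
    (nth 0%N mu i)%:Z * ((nth 0%N mu i)%:Z - 2 * (i.+1)%:Z + 1).

Definition conj_seq (s : seq nat) : seq nat :=
  mkseq (fun j => count (fun x => j < x)%N s) (head 0%N s).

Lemma conj_seq_part (s : seq nat) : is_part s -> is_part (conj_seq s).
Proof.
move=> _; apply/andP; split.
  rewrite /conj_seq /mkseq sorted_map.
  have /sub_sorted : subrel leq (relpre (fun j => count (fun x => j < x)%N s) geq).
    move=> i j le_ij; apply: sub_count => x /=; exact: leq_ltn_trans.
  by apply; apply: iota_sorted.
apply/negP => /mapP[j]; rewrite mem_iota add0n => /andP[_].
by case: s => [//|x s] /= ->.
Qed.

Definition part_conj (mu : part) : part := Part (conj_seq_part (partP mu)).

(* A symmetric function in x_1, x_2, ... is given by the family of its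
   restrictions to finitely many variables, f n being its image in
   K[x_1, ..., x_n] (all remaining variables set to 0). *)
Definition symfun (K : fieldType) := forall n : nat, {mpoly K[n]}.

Definition powsum (K : fieldType) (k : nat) : symfun K :=
  fun n => \sum_(i < n) 'X_i ^+ k.

(* det (x_i ^ (la_j + n - j)), for la with at most n parts *)
Definition alternant (K : fieldType) (la : part) (n : nat) : {mpoly K[n]} :=
  \det (\matrix_(i < n, j < n) ('X_i : {mpoly K[n]}) ^+ (nth 0%N la j + (n - j.+1))).

(* s_la (x_1, ..., x_n) is the quotient of the alternants of la and of the
   empty partition (the Vandermonde determinant); it is 0 if la has more than
   n parts. *)
Definition schur (K : fieldType) (la : part) : symfun K :=
  fun n => if (size la <= n)%N
           then xget 0 [set s | s * alternant K part0 n = alternant K la n]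
           else 0.

(* [is_LR nu la c]: s_nu s_la = \sum_mu c_mu s_mu, a finite sum. *)
Definition is_LR (K : fieldType) (nu la : part) (c : part -> K) : Prop :=
  finite_set [set mu | c mu != 0] /\
  forall n, schur K nu n * schur K la n
            = \sum_(mu \in [set: part]) c mu *: schur K mu n.

(* [LR K mu nu la] is the coefficient c^mu_(nu, la) of s_mu in s_nu s_la. *)
Definition LR (K : fieldType) (mu nu la : part) : K :=
  xget (fun=> 0) [set c | is_LR nu la c] mu.

(* s_(mu / nu) = \sum_la c^mu_(nu, la) s_la, the adjoint of the multiplication
   by s_nu for the inner product which makes Schur functions orthonormal *)
Definition skew_schur (K : fieldType) (mu nu : part) : symfun K :=
  fun n => \sum_(la \in [set: part]) LR K mu nu la *: schur K la n.

(* [is_spec v f y]: f = P(p_1, ..., p_d) for some polynomial P such that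
   y = P(v_1, ..., v_d). *)
Definition is_spec (K : fieldType) (v : nat -> K) (f : symfun K) (y : K) : Prop :=
  exists (d : nat) (P : {mpoly K[d]}),
    (forall n, f n = P \mPo [tuple powsum K k.+1 n | k < d]) /\
    y = P.@[fun k => v k.+1].

(* The specialization of symmetric functions that sends the power sum p_k to
   v k for k >= 1 (v 0 is not used). *)
Definition spec (K : fieldType) (v : nat -> K) (f : symfun K) : K :=
  xget 0 [set y | is_spec v f y].

(* C(q^(1/12)) is the field of rational functions in the variable q^(1/12). *)
Notation scalars R := {fraction {poly R[i]}}.

(* [qpow12 R k] is q^(k/12). *)
Definition qpow12 (R : realType) (k : int) : scalars R :=
  tofrac ('X : {poly R[i]}) ^ k.

Definition qint (R : realType) (n : nat) : scalars R :=
  qpow12 R (6 * n%:Z) - qpow12 R (- (6 * n%:Z)).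

Definition qfact (R : realType) (n : nat) : scalars R :=
  \prod_(1 <= k < n.+1) qint R k.

(* f(q^(-rho)) *)
Definition spec_qmrho (R : realType) (f : symfun (scalars R)) : scalars R :=
  spec (fun k => - (qint R k)^-1) f.

Definition W2 (R : realType) (mu nu : part) : scalars R :=
  (-1) ^+ (part_size mu + part_size nu) * qpow12 R (6 * (kappa mu + kappa nu)) *
  \sum_(eta \in [set: part])
    spec_qmrho (skew_schur (scalars R) mu eta) *
    spec_qmrho (skew_schur (scalars R) nu eta).

Definition W3 (R : realType) (mu1 mu2 mu3 : part) : scalars R :=
  \sum_(lt \in [set: part * part])
    (\sum_(eta \in [set: part])
       LR (scalars R) mu1 eta lt.1 *
       LR (scalars R) (part_conj mu3) eta (part_conj lt.2)) *
    qpow12 R (6 * kappa mu2 + 6 * kappa mu3) *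
    (W2 R (part_conj mu2) lt.1 * W2 R mu2 (part_conj lt.2) / W2 R mu2 part0).

Definition framed_vertex (R : realType) (a1 a2 a3 : int) (mu1 mu2 mu3 : part) :
    scalars R :=
  qpow12 R (6 * (a1 * kappa mu1 + a2 * kappa mu2 + a3 * kappa mu3)) *
  W3 R mu1 mu2 mu3.

(* The half-integer r + 1/2 is encoded by the integer r: negative half-integers
   correspond to negative integers, m + 1/2 to m, and - n - 1/2 to - n - 1. *)
Definition is_admissible (A : set int) : Prop :=
  finite_set [set r : int | A r /\ 0 <= r] /\ finite_set [set r : int | r < 0 /\ ~ A r].

Record admissible := Admissible {
  adm_set :> set int;
  admP : is_admissible adm_set }.

HB.instance Definition _ := gen_eqMixin admissible.
HB.instance Definition _ := gen_choiceMixin admissible.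

Lemma adm_add_subproof (A : admissible) (r : int) :
  is_admissible (A `|` [set r]).
Proof.
have [finp finn] := admP A; split.
  apply: (@sub_finite_set _ _ ([set s : int | adm_set A s /\ 0 <= s] `|` [set r])).
    by move=> s /= [[As|->] s0]; [left|right].
  by rewrite finite_setU; split=> //; apply: finite_set1.
by apply: sub_finite_set finn => s /= [s0 nAs]; split=> // As; apply: nAs; left.
Qed.

Definition adm_add (A : admissible) (r : int) : admissible :=
  Admissible (adm_add_subproof A r).

Lemma adm_del_subproof (A : admissible) (r : int) :
  is_admissible (A `\` [set r]).
Proof.
have [finp finn] := admP A; split.
  by apply: sub_finite_set finp => s /= [[As _] s0].
apply: (@sub_finite_set _ _ ([set s : int | s < 0 /\ ~ adm_set A s] `|` [set r])).
  move=> s /= [s0 nAs]; have [->|/eqP sr] := eqVneq s r; first by right.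
  by left; split=> // As; apply: nAs; split.
by rewrite finite_setU; split=> //; apply: finite_set1.
Qed.

Definition adm_del (A : admissible) (r : int) : admissible :=
  Admissible (adm_del_subproof A r).

Definition maya_set (mu : part) : set int :=
  [set (nth 0%N mu i)%:Z - (i.+1)%:Z | i in [set: nat]].

Lemma maya_subproof (mu : part) : is_admissible (maya_set mu).
Proof.
split.
  apply: (@sub_finite_set _ _
    [set (nth 0%N mu i)%:Z - (i.+1)%:Z | i in `I_(size mu)]).
    move=> _ /= [[i _ <-] i0]; exists i => //=.
    by rewrite ltnNge; apply/negP => le_i; move: i0; rewrite nth_default.
  by apply: finite_image; apply: finite_II.
apply: (@sub_finite_set _ _ [set - (i.+1)%:Z | i in `I_(size mu)]).
  case=> i /= [] // _ nA; exists i; last by rewrite NegzE.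
  rewrite /= ltnNge; apply/negP => le_i; apply: nA; exists i => //.
  by rewrite nth_default // sub0r NegzE.
by apply: finite_image; apply: finite_II.
Qed.

Definition maya (mu : part) : admissible := Admissible (maya_subproof mu).

(* Formal, possibly infinite, linear combinations of the semi-infinite wedges:
   [f A] is the coefficient of the wedge of A. *)
Definition fock (K : fieldType) := admissible -> K.

Definition wedge (K : fieldType) (A : admissible) : fock K :=
  fun B => (B == A)%:R.

Definition ket (K : fieldType) (mu : part) : fock K := wedge K (maya mu).

Definition lin_ext (K : fieldType) (T : admissible -> fock K) (f : fock K) :
    fock K :=
  fun B => \sum_(A \in [set: admissible]) f A * T A B.

Definition psi_wedge (K : fieldType) (r : int) (A : admissible) : fock K :=
  fun B => if r \in adm_set A then 0
           else (-1) ^+ #|` fset_set [set s : int | adm_set A s /\ r < s]|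
                * wedge K (adm_add A r) B.

(* If r is the k-th largest element of A, then k is the number of elements of A that are at least r. *)
Definition psi_star_wedge (K : fieldType) (r : int) (A : admissible) : fock K :=
  fun B => if r \in adm_set A
           then (-1) ^+ (#|` fset_set [set s : int | adm_set A s /\ r <= s]| + 1)
                * wedge K (adm_del A r) B
           else 0.

Definition psi (K : fieldType) (r : int) : fock K -> fock K :=
  lin_ext (psi_wedge K r).

Definition psi_star (K : fieldType) (r : int) : fock K -> fock K :=
  lin_ext (psi_star_wedge K r).

(* \sum_(m, n >= 0) A_(m, n) psi_(m + 1/2) psi*_(- n - 1/2) *)
Definition bilinear_op (K : fieldType) (A : nat -> nat -> K) (f : fock K) :
    fock K :=
  fun B => \sum_(mn \in [set: nat * nat])
             A mn.1 mn.2 * psi mn.1%:Z (psi_star (- mn.2%:Z - 1) f) B.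

Definition exp_op (K : fieldType) (X : fock K -> fock K) (f : fock K) : fock K :=
  fun B => \sum_(k \in [set: nat]) (k`!)%:R^-1 * iter k X f B.

Definition Acoef (R : realType) (a : int) (m n : nat) : scalars R :=
  (-1) ^+ n *
  qpow12 R (3 * ((m%:Z - n%:Z) * (m + n + 1)%:Z * (2 * a + 1))) *
  (qint R (m + n + 1) * qfact R m * qfact R n)^-1.

(* Main.v *)
Require Import Defs.
From mathcomp Require Import all_boot all_order all_fingroup all_algebra finmap.
From mathcomp Require Import complex fraction mpoly.
From mathcomp Require Import boolp classical_sets cardinality fsbigop reals.
From mathcomp Require Import zify ring.

(** Both sides are computed in closed form, wedge by wedge.  Write
    [k] = q^(k/2) - q^(-k/2) and encode a partition mu by its levels
    a_i = mu_i + L - i, for any L at least the number of parts; up to the shift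
    by L these are the elements of its Maya diagram.  The common value is
    q^((2a+1) kappa(mu)/4) times the weight
    prod_(i<j) [a_i - a_j] / prod_i [a_i]!, which does not depend on L
    ([weight_levels]).

    Vertex side.  Since c^mu_(0,la) = delta_(mu,la), the vertex
    W_(mu,0,0) is W_(0,mu), that is q^(kappa/2) s_mu(q^(-rho)) up to sign.
    Jacobi-Trudi and the Newton identities show that s_mu is one polynomial P in
    the power sums, whatever the number of variables ([schur_powsums]).  At the n
    points q^(1/2), ..., q^(n-1/2) the bialternant formula is a quotient of
    Vandermonde determinants, and equals a polynomial in t = q^n whose value at
    t = 0 is the weight up to a sign and a power of q ([schur_geom]); the power sums
    p_k = -(1 - t^k)/[k] are polynomials in t too.  Two polynomials that agree at
    all large powers of q agree at t = 0, where p_k = -1/[k].  The argument applies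
    to every P that represents s_mu, so the specialization is well defined and
    equal to this value ([spec_eq]).

    Fock side.  Fix L such that a wedge contains all half-integers below -L, and
    let S be its finite set of elements above -L, shifted by L.  A wedge is
    reached from the vacuum by k bilinears exactly if S has L elements, k of them
    at least L, and its coefficient in the k-th power is k! times the closed form
    ([iter_bilinear]).  For the induction, the last bilinear moved a particle
    from some level b < L to a level x of S.  For a fixed x the sum over b
    reproduces the closed form of S: after cancelling common factors and signs,
    this is the partial fraction expansion of a polynomial of degree L - 1 over
    the L nodes q^0, ..., q^(L-1) ([weight_expansion]).  The k choices of x give
    the factor k that turns (k-1)! into k!.

    Finally the wedges with card S = L are exactly the Maya diagrams of
    partitions ([level_set_surj], [maya_inj]). *)

Set Implicit Arguments.
Unset Strict Implicit.
Unset Printing Implicit Defensive.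

Import Order.TTheory GRing.Theory Num.Theory.

Local Open Scope classical_set_scope.
Local Open Scope ring_scope.

(** * Complete symmetric functions and Jacobi-Trudi determinants *)

Section Complete.
Variable A : comNzRingType.
Implicit Types (s : seq A) (f : nat -> A) (p : {poly A}).

(** The coefficient of T^a in the product of p and the generating series of f. *)
Definition conv p f (a : nat) : A := \sum_(k < a.+1) p`_k * f (a - k)%N.

(** h_k of a list of variables, by the recursion that (1 - x T) H(x :: s) = H(s)
    imposes on the generating series. *)
Fixpoint complete s : nat -> A :=
  if s is x :: s' then
    fix h k := if k is k'.+1 then complete s' k + x * h k' else 1
  else fun k => (k == 0)%N%:R.

Lemma complete0 s : complete s 0 = 1.
Proof. by case: s. Qed.

Lemma completeS x s k :
  complete (x :: s) k.+1 = complete s k.+1 + x * complete (x :: s) k.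
Proof. by []. Qed.

(** Peeling off one variable x, the terms in x^i on the left telescope through
    h_(k+1)(x :: s) = h_(k+1)(s) + x h_k(x :: s). *)
Lemma newton s k :
  \sum_(i < k) (\sum_(x <- s) x ^+ i.+1) * complete s (k - i.+1)
  = k%:R * complete s k.
Proof.
elim: s k => [|x s IHs] k.
  rewrite big1 => [|i _]; last by rewrite big_nil mul0r.
  by case: k => [|k]; rewrite /= ?mul0r ?mulr0.
set H := complete (x :: s).
pose T k := \sum_(i < k) x ^+ i.+1 * H (k - i.+1)%N.
have TS j : T j.+1 = x * H j + x * T j.
  rewrite /T big_ord_recl expr1 subSS subn0; congr (_ + _).
  by rewrite big_distrr; apply: eq_bigr => i _; rewrite /= exprS mulrA subSS.
have split_sum j : \sum_(i < j) (\sum_(y <- x :: s) y ^+ i.+1) * H (j - i.+1)%N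
    = T j + \sum_(i < j) (\sum_(y <- s) y ^+ i.+1) * H (j - i.+1)%N.
  by rewrite -big_split; apply: eq_bigr => i _; rewrite big_cons mulrDl.
rewrite split_sum.
elim: k => [|k IHk]; first by rewrite /T !big_ord0 mul0r add0r.
have -> : \sum_(i < k.+1) (\sum_(y <- s) y ^+ i.+1) * H (k.+1 - i.+1)%N
   = k.+1%:R * complete s k.+1
     + x * \sum_(i < k) (\sum_(y <- s) y ^+ i.+1) * H (k - i.+1)%N.
  rewrite -IHs big_ord_recr [X in _ = X + _]big_ord_recr /= subnn /H !complete0.
  rewrite -addrA [X in _ = _ + X]addrC addrA; congr (_ + _).
  rewrite big_distrr -big_split; apply: eq_bigr => i _ /=.
  rewrite subSS -(subnSK (ltn_ord i)).
  by rewrite mulrDr mulrCA.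
have -> : \sum_(i < k) (\sum_(y <- s) y ^+ i.+1) * H (k - i.+1)%N = k%:R * H k - T k.
  by rewrite -IHk addrC addKr.
rewrite TS [in RHS]/H completeS -/H -natr1; ring.
Qed.

(** E(-T) H(T) = 1; modulo T^(a+1) the series H is a polynomial, which allows
    the factors to be removed one at a time. *)
Lemma conv_complete s a :
  conv (\prod_(x <- s) (1 - x *: 'X)) (complete s) a = (a == 0)%N%:R.
Proof.
pose hp s := \poly_(k < a.+1) complete s k.
have convE p t b : (b <= a)%N -> conv p (complete t) b = (p * hp t)`_b.
  move=> ba; rewrite coefM; apply: eq_bigr => k _; rewrite coef_poly.
  by rewrite ltnS (leq_trans (leq_subr _ _) ba).
have E t b : (b <= a)%N ->
    ((\prod_(x <- t) (1 - x *: 'X)) * hp t)`_b = (b == 0)%N%:R.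
  elim: t b => [|x t IH] b ba.
    by rewrite big_nil mul1r coef_poly ltnS ba.
  rewrite big_cons mulrAC mulrC -(IH b ba) !coefM; apply: eq_bigr => k _.
  congr (_ * _); have kb : (b - k <= a)%N := leq_trans (leq_subr _ _) ba.
  rewrite mulrBl mul1r -scalerAl coefB coefZ coefXM !coef_poly ltnS kb.
  case: (b - k)%N kb => [|j] kb; first by rewrite mulr0 subr0 !complete0.
  by rewrite ltnS (ltnW kb) /= addrK.
by rewrite convE // E.
Qed.

Lemma conv_mul_linear x p f a :
  conv ((1 - x *: 'X) * p) f a.+1 = conv p f a.+1 - x * conv p f a.
Proof.
rewrite {1 2}/conv big_ord_recl [in RHS]big_ord_recl -addrA.
rewrite mulrBl mul1r -scalerAl !coefB !coefZ !coefXM mulr0 subr0; congr (_ + _).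
rewrite /conv big_distrr -sumrB; apply: eq_bigr => k _.
by rewrite coefB coefZ coefXM /= subSS mulrBl mulrA.
Qed.

(** Omitting the factor 1 - x_i T from E(-T) leaves E(-T) H(T) / (1 - x_i T),
    the geometric series in x_i T. *)
Lemma conv_complete_but n (x : 'I_n -> A) i a :
  conv (\prod_(j | j != i) (1 - x j *: 'X)) (complete [seq x j | j <- enum 'I_n]) a
  = x i ^+ a.
Proof.
set h := complete _; set r := \prod_(j | _) _.
have E b : conv ((1 - x i *: 'X) * r) h b = (b == 0)%N%:R.
  rewrite -(conv_complete [seq x j | j <- enum 'I_n]); congr conv.
  by rewrite big_map big_enum /= (bigD1 i).
elim: a => [|a IH].
  have := E 0%N; rewrite /conv !big_ord1 mulrBl mul1r -scalerAl coefB coefZ coefXM.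
  by rewrite /= mulr0 subr0 expr0.
by have := E a.+1; rewrite conv_mul_linear IH => /eqP; rewrite subr_eq0 exprS => /eqP.
Qed.

Lemma size_prod_linear (I : finType) (P : pred I) (x : I -> A) :
  (size (\prod_(j | P j) (1 - x j *: 'X) : {poly A})%R <= #|P|.+1)%N.
Proof.
apply: leq_trans (size_poly_prod_leq _ _) _; rewrite -sum1_card leq_subLR.
rewrite addnS ltnS -big_split; apply: leq_sum => j _.
apply: leq_trans (size_polyD _ _) _; rewrite size_poly1 size_polyN geq_max /=.
by apply: leq_trans (size_scale_leq _ _) _; rewrite size_polyX.
Qed.

(** The guard stands for the convention that h_k = 0 for k < 0. *)
Definition jt_mx (n : nat) (la : nat -> nat) f : 'M[A]_n :=
  \matrix_(i < n, j < n) (if (i <= la i + j)%N then f (la i + j - i)%N else 0).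

Lemma jt_mx_row n la f p (i : 'I_n) : (size p <= n)%N ->
  \sum_(k < n) jt_mx n la f i k * p`_(n - k.+1) = conv p f (la i + (n - i.+1)).
Proof.
move=> sp; set a := (la i + _)%N.
rewrite (reindex_inj rev_ord_inj) /=.
have -> : \sum_(k < n) jt_mx n la f i (rev_ord k) * p`_(n - (n - k.+1).+1)
          = \sum_(k < n) (if (k <= a)%N then p`_k * f (a - k)%N else 0).
  apply: eq_bigr => k _; rewrite mxE /=.
  have -> : (n - (n - k.+1).+1 = k)%N by have := ltn_ord k; lia.
  have -> : (i <= la i + (n - k.+1))%N = (k <= a)%N.
    by rewrite /a; have := ltn_ord k; have := ltn_ord i; lia.
  case: ifP => ka; last by rewrite mul0r.
  rewrite mulrC; congr (_ * f _).
  by rewrite /a; have := ltn_ord k; have := ltn_ord i; lia.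
rewrite -big_mkcond /= /conv.
pose F k := p`_k * f (a - k)%N.
rewrite (big_ord_widen_cond (n + a.+1) (fun k => k <= a)%N F) ?leq_addr //.
rewrite [RHS](big_ord_widen (n + a.+1) F) ?leq_addl //.
rewrite [RHS](bigID (fun k : 'I__ => k < n)%N) /= [X in _ = _ + X]big1 ?addr0.
  by apply: eq_bigl => k; rewrite ltnS.
move=> k /andP[_ kn]; rewrite /F nth_default ?mul0r //.
by rewrite (leq_trans sp) // leqNgt.
Qed.

(** By [conv_complete_but] the alternant matrix is the product of a matrix that
    does not depend on la and the transpose of the Jacobi-Trudi matrix. *)
Lemma jt_alternant n (la : nat -> nat) (x : 'I_n -> A) :
  \det (\matrix_(i < n, j < n) x i ^+ (la j + (n - j.+1))) =
  \det (\matrix_(i < n, k < n) (\prod_(j | j != i) (1 - x j *: 'X))`_(n - k.+1))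
  * \det (jt_mx n la (complete [seq x j | j <- enum 'I_n])).
Proof.
rewrite -[\det (jt_mx _ _ _)]det_tr -det_mulmx; congr (\det _).
apply/matrixP => i j; rewrite !mxE -(conv_complete_but x) -jt_mx_row.
  by apply: eq_bigr => k _; rewrite !mxE mulrC.
apply: leq_trans (size_prod_linear _ _) _.
by rewrite cardC1 card_ord prednK // (leq_trans _ (ltn_ord i)).
Qed.

(** A row beyond the last part is that of a unitriangular matrix. *)
Lemma jt_mx_stable l n (la : nat -> nat) f : (forall i, l <= i -> la i = 0)%N -> f 0%N = 1 ->
  (l <= n)%N -> \det (jt_mx n la f) = \det (jt_mx l la f).
Proof.
move=> la0 f0; elim: n => [|n IH]; first by rewrite leqn0 => /eqP ->.
rewrite leq_eqVlt => /orP[/eqP <- //|ln]; rewrite -IH //.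
rewrite (expand_det_row _ ord_max) big_ord_recr /= big1 => [|j _].
  rewrite add0r mxE /= la0 // add0n leqnn subnn f0 mul1r /cofactor.
  rewrite addnn -signr_odd odd_double mul1r; congr (\det _).
  by apply/matrixP => i j; rewrite !mxE !lift_max.
by rewrite mxE /= la0 // add0n leqNgt ltn_ord mul0r.
Qed.

Lemma jt_mx0 n f : f 0%N = 1 -> \det (jt_mx n (fun=> 0%N) f) = 1.
Proof. by move=> f0; rewrite (@jt_mx_stable 0) // det_mx00. Qed.

(** With fewer than l variables, E(-T) H(T) = 1 is a linear relation between the
    columns, in which the last column has coefficient 1. *)
Lemma jt_mx_vanish l (la : nat -> nat) s : (size s < l)%N ->
  (forall i, i < l -> 0 < la i)%N -> \det (jt_mx l la (complete s)) = 0.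
Proof.
case: l => // l sl la0; set M := jt_mx _ _ _.
pose p := \prod_(x <- s) (1 - x *: 'X) : {poly A}.
have sp : (size p <= l.+1)%N.
  rewrite /p (big_nth 0) big_mkord.
  by apply: leq_trans (size_prod_linear _ _) _; rewrite cardT size_enum_ord.
(* the relation between the columns, reversed because jt_mx indexes them upwards *)
pose v : 'cV_l.+1 := \col_k p`_(l.+1 - k.+1).
have Mv : M *m v = 0.
  apply/matrixP => i j; rewrite !mxE.
  under eq_bigr do rewrite [v _ _]mxE.
  rewrite jt_mx_row // conv_complete addn_eq0.
  by case: (la i) (la0 i (ltn_ord i)).
have := congr1 (mulmx (\adj M)) Mv; rewrite mulmxA mul_adj_mx mulmx0.
move/matrixP/(_ ord_max ord0); rewrite mul_scalar_mx !mxE /= subnn.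
suff -> : p`_0 = 1; first by rewrite mulr1.
rewrite /p -horner_coef0 horner_prod big1 // => x _.
by rewrite !hornerE ?mulr0 ?oppr0 ?addr0 ?subr0. 
Qed.

End Complete.

(** * Schur polynomials *)

Lemma part_nth_leq (mu : part) i j : (i <= j)%N -> (nth 0 mu j <= nth 0 mu i)%N.
Proof.
move=> ij; have [/andP[srt _]] := (partP mu, tt); case: (ltnP j (size mu)) => jm.
  have tr : transitive geq by move=> a b c /= ba cb; exact: leq_trans cb ba.
  by have /= -> := sorted_leq_nth tr leqnn 0%N srt _ _ (leq_ltn_trans ij jm) jm ij.
by rewrite (nth_default _ jm).
Qed.

Lemma part_nth_gt0 (mu : part) i : (0 < nth 0 mu i)%N = (i < size mu)%N.
Proof.
case: (ltnP i (size mu)) => im; last by rewrite nth_default.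
have /andP[_] := partP mu; rewrite lt0n; apply: contraNneq => <-.
exact: mem_nth.
Qed.

Lemma part_ext (mu nu : part) : (forall i, nth 0%N mu i = nth 0%N nu i) -> mu = nu.
Proof.
move=> E; apply: val_inj; apply: (@eq_from_nth _ 0%N) => [|i _]; last exact: E.
have sub (a b : part) : (forall i, nth 0%N a i = nth 0%N b i) -> (size a <= size b)%N.
  move=> Eab; rewrite leqNgt -part_nth_gt0 Eab part_nth_gt0 ltnn //.
by apply/eqP; rewrite eqn_leq !sub.
Qed.

Definition level (mu : part) (n i : nat) : nat := nth 0%N mu i + (n - i.+1).

Lemma level_lt (mu : part) n i j : (i < j < n)%N -> (level mu n j < level mu n i)%N.
Proof.
case/andP=> ij jn; rewrite /level -addnS leq_add ?part_nth_leq ?(ltnW ij) //; lia.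
Qed.

Lemma monotone_perm n (s : 'S_n) :
  (forall i j : 'I_n, i < j -> s i < s j)%N -> s = 1%g.
Proof.
(* an increasing permutation satisfies i <= t i, and so does its inverse *)
have ge_id (t : 'S_n) : (forall i j : 'I_n, i < j -> t i < t j)%N ->
    forall i : 'I_n, (i <= t i)%N.
  move=> mt; case=> i; elim: i => [|i IH] // lin.
  exact: leq_ltn_trans (IH (ltnW lin)) (mt (Ordinal (ltnW lin)) (Ordinal lin) _).
move=> ms; have mV : forall (i j : 'I_n), (i < j)%N -> (s^-1%g i < s^-1%g j)%N.
  move=> i j; rewrite !ltnNge; apply: contra; rewrite leq_eqVlt => /orP[/eqP/val_inj/perm_inj -> // |].
  by move/ms; rewrite !permKV => /ltnW.
apply/permP => i; rewrite perm1; apply: val_inj; apply/eqP; rewrite /= eqn_leq ge_id //.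
by rewrite andbT; have := ge_id _ mV (s i); rewrite permK.
Qed.

Section Schur.
Variable K : fieldType.

(** In the Leibniz expansion of the alternant of mu, the exponents are the
    permutations of a strictly decreasing sequence, hence only the identity
    contributes a strictly decreasing monomial. *)
Lemma alternant_coeff (mu nu : part) n : (size mu <= n)%N -> (size nu <= n)%N ->
  (alternant K mu n)@_[multinom level nu n i | i < n] = (mu == nu)%:R.
Proof.
move=> smu snu; rewrite /alternant /determinant raddf_sum.
have E (s : 'S_n) : ([multinom level mu n (s i) | i < n] ==
    [multinom level nu n i | i < n]) = (s == 1%g) && (mu == nu).
  apply/eqP/andP => [/mnmP H|[/eqP -> /eqP ->]]; last by apply/mnmP => i; rewrite !mnmE perm1.
  have {}H i : level mu n (s i) = level nu n i by have := H i; rewrite !mnmE.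
  have s1 : s = 1%g.
    apply: monotone_perm => i j ij; rewrite ltnNge; apply/negP => ji.
    have : (level nu n j < level nu n i)%N by apply: level_lt; rewrite ij /=.
    rewrite -!H ltnNge; move: ji; rewrite leq_eqVlt => /orP[/eqP/val_inj->|ji].
      by rewrite leqnn.
    by rewrite ltnW // level_lt // ji /=.
  split; apply/eqP => //; apply: part_ext => i; case: (ltnP i n) => iltn.
    by have := H (Ordinal iltn); rewrite s1 perm1 => /addIn.
  by rewrite !nth_default // (leq_trans _ iltn).
have coef (s : 'S_n) : ((-1) ^+ s * \prod_i (\matrix_(i < n, j < n)
      ('X_i : {mpoly K[n]}) ^+ (nth 0%N mu j + (n - j.+1))) i (s i))
        @_[multinom level nu n i | i < n]
    = (-1) ^+ s * ((s == 1%g) && (mu == nu))%:R.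
  under eq_bigr do rewrite mxE.
  rewrite mulr_sign -scaler_sign mcoeffZ -E -mcoeffX mpolyXE_id; congr (_ * _@_ _).
  by apply: eq_bigr => i _; rewrite mnmE.
rewrite /= (eq_bigr _ (fun s _ => coef s)) (bigD1 1%g) //= big1 => [|s /negPf ->].
  by rewrite odd_perm1 mul1r eqxx addr0.
by rewrite mulr0.
Qed.

Lemma alternant0_neq0 n : alternant K part0 n != 0.
Proof.
apply/eqP => E; have := @alternant_coeff part0 part0 n isT isT.
by rewrite E mcoeff0 eqxx => /eqP; rewrite eq_sym oner_eq0.
Qed.

Definition powsums d n := [tuple powsum K k.+1 n | k < d].

Hypothesis char0 : forall k, k.+1%:R != 0 :> K.

(** The Newton identities solve for h_k, and the same polynomial works for all
    numbers n of variables. *)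
Lemma complete_powsum d k : (k <= d)%N -> exists P : {mpoly K[d]},
  forall n, P \mPo powsums d n
            = complete [seq 'X_i | i <- enum 'I_n] k.
Proof.
elim/ltn_ind: k => -[|k] IH kd.
  by exists 1 => n; rewrite comp_mpoly1 complete0.
have ex (i : 'I_k.+1) : exists P : {mpoly K[d]},
    forall n, P \mPo powsums d n
              = complete [seq 'X_i | i <- enum 'I_n] (k.+1 - i.+1).
  by apply: IH; have := ltn_ord i; lia.
case: (choice ex) => Q HQ.
exists (k.+1%:R^-1 *: \sum_(i < k.+1) 'X_(widen_ord kd i) * Q i) => n.
rewrite comp_mpolyZ (raddf_sum (comp_mpoly (powsums d n))).
set xs := [seq _ | _ <- _].
have psE i : \sum_(x <- xs) x ^+ i = powsum K i n by rewrite big_map big_enum.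
have := newton xs k.+1; rewrite mulr_natl -scaler_nat => /(congr1 (GRing.scale k.+1%:R^-1)).
rewrite scalerA mulVf // scale1r => <-; congr (_ *: _).
by apply: eq_bigr => i _; rewrite psE /= (rmorphM (comp_mpoly (powsums d n))) /= comp_mpolyXU HQ -tnth_nth tnth_mktuple.
Qed.

Lemma schurP (mu : part) n (s : {mpoly K[n]}) : (size mu <= n)%N ->
  s * alternant K part0 n = alternant K mu n -> schur K mu n = s.
Proof.
move=> smu E; rewrite /schur smu; apply: xget_unique => //= t Et.
by apply: (mulIf (alternant0_neq0 n)); rewrite E Et.
Qed.

Lemma jt_mx_alternant (mu : part) n : (size mu <= n)%N ->
  \det (jt_mx (size mu) (fun i => nth 0%N mu i)
          (complete [seq 'X_i | i <- enum 'I_n])) * alternant K part0 n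
  = alternant K mu n.
Proof.
move=> le_n; rewrite /alternant !(@jt_alternant _ _ (fun i => nth _ _ i)).
rewrite mulrCA; congr (_ * _).
have -> : jt_mx n (fun i => nth 0%N part0 i) (complete [seq 'X_i | i <- enum 'I_n])
        = jt_mx n (fun=> 0%N) (complete [seq 'X_i : {mpoly K[n]} | i <- enum 'I_n]).
  by apply/matrixP => i j; rewrite !mxE nth_nil.
rewrite jt_mx0 ?complete0 // mulr1.
rewrite -(@jt_mx_stable _ (size mu) n _ _ _ _ le_n) ?complete0 //.
by move=> i; exact: nth_default.
Qed.

Lemma schur_alternant (mu : part) n : (size mu <= n)%N ->
  schur K mu n * alternant K part0 n = alternant K mu n.
Proof. by move=> le_n; rewrite (schurP le_n (jt_mx_alternant le_n)) jt_mx_alternant. Qed.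

(** Also true when mu has more than n parts: both sides vanish then. *)
Lemma jacobi_trudi (mu : part) n :
  schur K mu n = \det (jt_mx (size mu) (fun i => nth 0%N mu i)
                         (complete [seq 'X_i | i <- enum 'I_n])).
Proof.
case: (ltnP n (size mu)) => [lt_n|le_n]; last exact: schurP (jt_mx_alternant le_n).
rewrite /schur leqNgt lt_n jt_mx_vanish ?size_map -?enumT ?size_enum_ord // => i.
by rewrite part_nth_gt0.
Qed.

Lemma schur_powsums (mu : part) : exists d (P : {mpoly K[d]}),
  forall n, schur K mu n = P \mPo powsums d n.
Proof.
(* every entry h_k of the determinant has k < d *)
pose d := (nth 0 mu 0 + size mu)%N; exists d.
have ex k : exists P : {mpoly K[d]}, (k <= d)%N ->
    forall n, P \mPo powsums d n = complete [seq 'X_i | i <- enum 'I_n] k.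
  by case: (leqP k d) => [/complete_powsum[P HP]|_]; [exists P|exists 0].
case: (choice ex) => Q HQ.
exists (\det (jt_mx (size mu) (fun i => nth 0%N mu i) Q)) => n.
rewrite jacobi_trudi -(det_map_mx (comp_mpoly (powsums d n))); congr (\det _); apply/matrixP => i j; rewrite !mxE.
case: ifP => ij; last by rewrite rmorph0.
rewrite /= HQ // /d; have := part_nth_leq mu (leq0n i); have := ltn_ord j; lia.
Qed.

End Schur.

(** * Littlewood-Richardson coefficients with an empty index *)

Section LR.
Variable K : fieldType.

Lemma schur_part0 n : schur K part0 n = 1.
Proof. by apply: schurP => //; rewrite mul1r. Qed.

Lemma schur_no_var (mu : part) : schur K mu 0 = (mu == part0)%:R.
Proof.
have [->|mu0] := eqVneq mu part0; first exact: schur_part0.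
rewrite /schur leqn0 size_eq0; case: eqP => // E.
by case/eqP: mu0; apply: val_inj.
Qed.

(** Schur functions are linearly independent: with enough variables, the
    coefficient of c at nu is read off at one monomial of the alternants. *)
Lemma is_LR_part0 (la : part) (c : part -> K) :
  is_LR part0 la c <-> c = (fun mu => (mu == la)%:R).
Proof.
split=> [[fin_c E]|->]; last first.
  split=> [|n].
    apply: (sub_finite_set _ (finite_set1 la)) => mu /=.
    by case: (mu =P la) => [->|_] //; rewrite eqxx.
  rewrite (fsbigTE [fset la]%fset) => [|mu]; last first.
    by rewrite inE => /negPf ->; rewrite scale0r.
  by rewrite big_seq_fset1 eqxx scale1r schur_part0 mul1r.
apply/funext => nu.
pose X := fset_set [set mu | c mu != 0].
(* enough variables for all the partitions involved *)
pose n := (size la + size nu + \sum_(mu <- X) size mu)%N.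
have := congr1 (fun p => (p * alternant K part0 n)@_[multinom level nu n i | i < n]) (E n).
rewrite schur_part0 mul1r schur_alternant ?alternant_coeff ?(eq_sym la); last 3 first.
- by rewrite /n; lia.
- by rewrite /n; lia.
- by rewrite /n; lia.
move=> ->; rewrite (fsbigTE X) => [|mu]; last first.
  rewrite in_fset_set // => muX; have -> : c mu = 0; last by rewrite scale0r.
  by apply/eqP; apply: contraNT muX => cmu; rewrite inE.
rewrite big_distrl raddf_sum /= (eq_big_seq (fun mu => (mu == nu)%:R * c mu)).
  case: (boolP (nu \in X)) => nuX.
    rewrite (big_fsetD1 nu) //= eqxx mul1r big_seq big1 ?addr0 // => mu.
    by rewrite !inE => /andP[/negPf -> _]; rewrite mul0r.
  rewrite big_seq big1 => [|mu muX].
    apply/eqP; apply: contraNT nuX => cnu.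
    by rewrite in_fset_set // inE.
  by case: eqP => [E'|_]; [rewrite -E' muX in nuX|rewrite mul0r].
move=> mu muX /=; have le_mu : (size mu <= n)%N.
  by rewrite /n (big_fsetD1 mu) //=; lia.
rewrite -scalerAl mcoeffZ schur_alternant // alternant_coeff // 1?mulrC //.
by rewrite /n; lia.
Qed.

Lemma LR_part0l (mu la : part) : LR K mu part0 la = (mu == la)%:R.
Proof.
rewrite /LR (@xget_unique _ _ _ (fun mu => (mu == la)%:R)) //.
  by apply/is_LR_part0.
by move=> c /is_LR_part0.
Qed.

(** With no variable at all, s_nu is 1 or 0 according to whether nu is empty, so
    the expansion of s_nu s_la reduces to its coefficient at the empty partition. *)
Lemma LR_part0 (nu la : part) :
  LR K part0 nu la = ((nu == part0) && (la == part0))%:R.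
Proof.
have [->|nu0] := eqVneq nu part0; first by rewrite LR_part0l eq_sym.
rewrite /LR; case: xgetP => [c _ [_ /(_ 0%N)]|] //=.
rewrite !schur_no_var (negPf nu0) mul0r (fsbigTE [fset part0]%fset) => [|mu].
  by rewrite big_seq_fset1 schur_part0 alg_mpolyC => /esym/eqP;
     rewrite mpolyC_eq0 => /eqP.
by rewrite inE schur_no_var => /negPf ->; rewrite scaler0.
Qed.

Lemma skew_schur_part0r (mu : part) : skew_schur K mu part0 = schur K mu.
Proof.
apply/functional_extensionality_dep => n; rewrite /skew_schur.
rewrite (fsbigTE [fset mu]%fset) => [|la]; last first.
  by rewrite inE LR_part0l eq_sym => /negPf ->; rewrite scale0r.
by rewrite big_seq_fset1 LR_part0l eqxx scale1r.
Qed.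

Lemma skew_schur_part0l (eta : part) :
  eta != part0 -> skew_schur K part0 eta = fun=> 0.
Proof.
move=> /negPf eta0; apply/functional_extensionality_dep => n.
by apply: fsbig1 => la _; rewrite LR_part0 eta0 scale0r.
Qed.

End LR.

(** * Brackets and the weight of a set of levels *)

Section Bracket.
Variable F : fieldType.
Variable u : F.
Hypothesis u_neq0 : u != 0.
Hypothesis u_aperiodic : forall n, u ^+ n.+1 != 1.

(** The quantum integer [k], extended to negative k, with u for q^(1/2). *)
Definition brack (k : int) : F := u ^ k - u ^ (- k).

Definition bfact (n : nat) : F := \prod_(1 <= k < n.+1) brack k.

Lemma brackN k : brack (- k) = - brack k.
Proof. by rewrite /brack opprK opprB. Qed.

Lemma expz_eq1 (k : int) : (u ^ k == 1) = (k == 0).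
Proof.
apply/idP/eqP => [|->]; last by rewrite expr0z.
case: k => [[|n]|n] //; first by rewrite -exprnP (negPf (u_aperiodic n)).
by rewrite NegzE -invr_expz -exprnP invr_eq1 (negPf (u_aperiodic n)).
Qed.

Lemma brack_neq0 k : k != 0 -> brack k != 0.
Proof.
apply: contra; rewrite subr_eq0 => /eqP E.
have : u ^ (k + k) == 1 by rewrite expfzDr // {1}E -expfzDr // addNr.
by rewrite expz_eq1; lia.
Qed.

Lemma brackB (a b : int) : brack (a - b) = u ^ (- (a + b)) * (u ^ (2 * a) - u ^ (2 * b)).
Proof. by rewrite /brack mulrBr -!expfzDr //; congr (_ ^ _ - _ ^ _); ring. Qed.

Lemma bfactS n : bfact n.+1 = bfact n * brack n.+1.
Proof. by rewrite /bfact big_nat_recr. Qed.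

Lemma bfact0 : bfact 0 = 1.
Proof. by rewrite /bfact big_geq. Qed.

Lemma bfact_neq0 n : bfact n != 0.
Proof.
elim: n => [|n IH]; first by rewrite bfact0 oner_neq0.
by rewrite bfactS mulf_neq0 ?brack_neq0.
Qed.

(** The Vandermonde product of brackets, with each pair taken in the order that
    makes the argument positive; this makes it independent of the order of s. *)
Definition vdm (s : seq nat) : F :=
  \prod_(a <- s) \prod_(b <- s | (b < a)%N) brack (a%:Z - b%:Z).

Definition weight (s : seq nat) : F := vdm s / \prod_(a <- s) bfact a.

Lemma weight_perm s t : perm_eq s t -> weight s = weight t.
Proof.
move=> st; rewrite /weight /vdm (perm_big _ st) [X in _ / X](perm_big _ st) /=.
by congr (_ / _); apply: eq_bigr => a _; apply: perm_big.
Qed.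

Lemma prod_bfact_neq0 (s : seq nat) : \prod_(a <- s) bfact a != 0.
Proof. by rewrite prodf_seq_neq0; apply/allP => a _; rewrite bfact_neq0. Qed.

(** The new pairs (a + 1, 0) contribute exactly the factors by which the
    factorials grow. *)
Lemma weight_shift s : weight (0%N :: map S s) = weight s.
Proof.
rewrite /weight /vdm !big_cons !big_map bfact0 mul1r.
rewrite (eq_bigl (fun=> false)) // big_pred0_eq mul1r.
pose P := \prod_(a <- s) brack a.+1.
have P0 : P != 0 by rewrite prodf_seq_neq0; apply/allP => a _; rewrite brack_neq0.
have -> : \prod_(a <- s) bfact a.+1 = \prod_(a <- s) bfact a * P.
  by rewrite -big_split; apply: eq_bigr => a _; rewrite bfactS.
rewrite (eq_bigr (fun a => brack a.+1 *
  \prod_(b <- s | (b < a)%N) brack (a%:Z - b%:Z))) => [|a _].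
  by rewrite big_split /= -/P; field; rewrite P0 prod_bfact_neq0.
rewrite big_cons big_map subr0; congr (_ * _); apply: eq_bigr => b _.
by congr brack; lia.
Qed.

Definition levels (mu : part) (n : nat) : seq nat := mkseq (level mu n) n.

Lemma levelsS (mu : part) n : (size mu <= n)%N ->
  levels mu n.+1 = rcons (map S (levels mu n)) 0%N.
Proof.
move=> mun; rewrite /levels /mkseq -[in LHS]addn1 iotaD map_cat /= cats1; congr rcons.
  rewrite -map_comp; apply/eq_in_map => i; rewrite mem_iota /level /=; lia.
by rewrite add0n /level nth_default // addn1 subnn.
Qed.

(** Adding a zero part shifts all levels by one and adds the level 0. *)
Lemma weight_levels (mu : part) n : (size mu <= n)%N ->
  weight (levels mu n) = weight (levels mu (size mu)).
Proof.
elim: n => [|n IH]; first by rewrite leqn0 => /eqP ->.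
rewrite leq_eqVlt => /orP[/eqP -> //|]; rewrite ltnS => mun.
rewrite -IH // levelsS // -[RHS]weight_shift; apply: weight_perm.
by rewrite perm_rcons.
Qed.

Lemma weight_levels0 n : weight (levels part0 n) = 1.
Proof. by rewrite weight_levels // /weight /vdm !big_nil divr1. Qed.

Lemma big_levels (T : Type) (idx : T) (op : T -> T -> T) (mu : part) n
    (P : pred nat) (f : nat -> T) :
  \big[op/idx]_(a <- levels mu n | P a) f a =
  \big[op/idx]_(i < n | P (level mu n i)) f (level mu n i).
Proof. by rewrite big_map -{1}(subn0 n) big_mkord. Qed.

Lemma vdm_levels (mu : part) n :
  vdm (levels mu n) = \prod_(i < n) \prod_(j < n | (i < j)%N)
                         brack ((level mu n i)%:Z - (level mu n j)%:Z).
Proof.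
rewrite /vdm big_levels; apply: eq_bigr => i _; rewrite big_levels.
apply: eq_bigl => j; case: (ltngtP i j) => ij.
- by rewrite level_lt // ij /=.
- by apply/negbTE; rewrite -leqNgt ltnW // level_lt // ij /=.
- by rewrite ij ltnn.
Qed.

(** Each index i occurs once with every other index. *)
Lemma prod_pairs n (y : 'I_n -> F) :
  \prod_(i < n) \prod_(j < n | (i < j)%N) (y i * y j) * \prod_(i < n) y i
  = (\prod_(i < n) y i) ^+ n.
Proof.
have -> : (\prod_(i < n) y i) ^+ n = \prod_(i < n) \prod_(j < n) y j.
  by rewrite prodr_const card_ord.
under [in RHS]eq_bigr => i _ do
  rewrite (bigD1 i) //= (bigID (fun j : 'I_n => i < j)%N) /=.
rewrite big_split [RHS]mulrC /=; congr (_ * _).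
under eq_bigr => i _ do rewrite big_split /=.
rewrite !big_split [LHS]mulrC /=; congr (_ * _).
  apply: eq_bigr => i _; apply: eq_bigl => j; case: (ltnP i j) => ij; rewrite ?andbF //.
  by rewrite andbT -val_eqE gtn_eqF.
rewrite (exchange_big_dep predT) //=; apply: eq_bigr => i _; apply: eq_bigl => j.
by rewrite -leqNgt -val_eqE ltn_neqAle.
Qed.

Definition geom_pt n (i : 'I_n) : F := u ^+ i.*2.+1.

(** At the odd powers of u the alternant is, up to column factors, the
    Vandermonde determinant at the points u^(2 a_j). *)
Lemma alternant_geom (mu : part) n :
  (alternant F mu n).@[@geom_pt n] =
    (\prod_(i < n) \prod_(j < n | (i < j)%N) -1) *
    (\prod_(i < n) u ^+ level mu n i) ^+ n * vdm (levels mu n).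
Proof.
rewrite /alternant -(det_map_mx (meval (@geom_pt n))).
pose z : 'rV[F]_n := \row_j u ^+ (level mu n j).*2.
have -> : map_mx (meval (@geom_pt n))
     (\matrix_(i, j) 'X_i ^+ (nth 0%N mu j + (n - j.+1)))
   = Vandermonde n z *m diag_mx (\row_j u ^+ level mu n j).
  apply/matrixP => i j; rewrite mul_mx_diag !mxE rmorphXn /= mevalXU /geom_pt.
  rewrite -!exprM -exprD; congr (u ^+ _); rewrite -/(level mu n j).
  by rewrite -!muln2; lia.
rewrite det_mulmx det_diag det_Vandermonde vdm_levels.
under [X in _ * X = _]eq_bigr do rewrite mxE.
rewrite -prod_pairs mulrAC; rewrite !mulrA; congr (_ * _).
rewrite -!big_split /=; apply: eq_bigr => i _; rewrite -!big_split /=.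
apply: eq_bigr => j _; rewrite !mxE brackB !exprnP -opprB -!mul2n !PoszM.
rewrite -!expfzDr // mulN1r !mulNr; congr (- _).
by rewrite mulrAC -expfzDr // addNr expr0z mul1r.
Qed.

(** The polynomial g with s_mu(u, u^3, ..., u^(2n-1)) = g(u^(2n)): a form of the
    hook-content formula in which only the contents involve n. *)
Definition schur_geom_poly (mu : part) : {poly F} :=
  (weight (levels mu (size mu)))%:P *
  \prod_(i < size mu) \prod_(k < nth 0%N mu i)
     ((- u ^ (i%:Z - k%:Z)) *: (1 - u ^ (2 * (k%:Z - i%:Z)) *: 'X)).

(** In the quotient of the two evaluated alternants, Vandermonde products become
    weights times factorials; the weights do not involve n, and the quotient of
    factorials [mu_i + n - i]! / [n - i]! is the product of [n + c] over the
    contents c of row i. *)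
Lemma schur_geom (mu : part) n : (size mu <= n)%N ->
  (schur F mu n).@[@geom_pt n] = (schur_geom_poly mu).[u ^+ n.*2].
Proof.
move=> mun; pose D := \prod_(i < n) bfact (level part0 n i).
pose U nu := \prod_(i < n) u ^+ level nu n i.
have prodE nu : \prod_(a <- levels nu n) bfact a = \prod_(i < n) bfact (level nu n i).
  exact: big_levels.
have vdmE (nu : part) : (size nu <= n)%N -> vdm (levels nu n) =
    weight (levels nu (size nu)) * \prod_(i < n) bfact (level nu n i).
  by move=> nun; rewrite -(weight_levels nun) -prodE /weight divfK ?prod_bfact_neq0.
have D0 : D != 0 by rewrite /D -prodE prod_bfact_neq0.
have U0 nu : U nu != 0 by apply/prodf_neq0 => i _; rewrite expf_neq0.
have := congr1 (meval (@geom_pt n)) (@schur_alternant F mu n mun).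
rewrite rmorphM /= !alternant_geom -/(U _) -/(U _) (vdmE part0) // (vdmE mu) //.
rewrite weight_levels0 mul1r -/D.
set s := _.@[_]; set c := \prod_(i < n) _.
have c0 : c != 0.
  by apply/prodf_neq0 => i _; apply/prodf_neq0 => j _; rewrite oppr_eq0 oner_eq0.
move=> E; have {}E : s = weight (levels mu (size mu)) *
    ((U mu / U part0) ^+ n * (\prod_(i < n) bfact (level mu n i) / D)).
  apply: (@mulIf _ (c * U part0 ^+ n * D)); first by rewrite !mulf_neq0 // expf_neq0.
  rewrite E exprMn exprVn; set w := weight _; set B := \prod_(i < n) _.
  have Un0 : U part0 ^+ n != 0 by rewrite expf_neq0.
  by field; rewrite Un0 D0.
rewrite E /schur_geom_poly hornerM hornerC; congr (_ * _).
rewrite horner_prod.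
have -> : U mu / U part0 = \prod_(i < n) u ^+ nth 0%N mu i.
  rewrite -prodf_div; apply: eq_bigr => i _.
  by rewrite /level nth_nil add0n exprD mulfK ?expf_neq0.
rewrite -prodrXl /D -prodf_div -big_split /=.
rewrite [RHS](big_ord_widen n (fun i => (\prod_(k < nth 0%N mu i)
     ((- u ^ (i%:Z - k%:Z)) *: (1 - u ^ (2 * (k%:Z - i%:Z)) *: 'X))).[u ^+ n.*2]) mun).
rewrite [RHS]big_mkcond; apply: eq_bigr => i _; rewrite /level nth_nil add0n.
case: ifPn => [im|]; last first.
  by rewrite -leqNgt => im; rewrite nth_default // expr1n add0n divff ?bfact_neq0 ?mul1r.
rewrite horner_prod; elim: (nth 0%N mu i) => [|m IH].
  by rewrite big_ord0 expr1n add0n divff ?bfact_neq0 ?mul1r.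
rewrite big_ord_recr -IH /= exprS exprMn addSn bfactS hornerZ !hornerE.
have -> : brack (m + (n - i.+1)).+1 = u ^ (- n%:Z + i%:Z - m%:Z) *
    (- (1 - u ^ (2 * (m%:Z - i%:Z)) * u ^+ n.*2)).
  rewrite opprB exprnP -expfzDr // mulrBr mulr1 -expfzDr // /brack.
  by congr (_ ^ _ - _ ^ _); rewrite -?mul2n ?PoszM; have := ltn_ord i; lia.
have -> : u ^ (- n%:Z + i%:Z - m%:Z) = u ^ (i%:Z - m%:Z) / u ^+ n.
  by rewrite exprnP invr_expz -expfzDr //; congr (_ ^ _); ring.
have b0 := bfact_neq0 (n - i.+1); have un0 : u ^+ n != 0 by rewrite expf_neq0.
rewrite /=; move: (u ^+ n) (u ^+ m ^+ n) (bfact _) (bfact _) (u ^ _) (u ^ _) (u ^+ _) b0 un0.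
by move=> A1 A2 A3 A4 A5 A6 A7 A40 A10; field; rewrite A10 A40.
Qed.

End Bracket.

(** * Specialization at q^(-rho) *)

Section Spec.
Variable F : fieldType.
Variable u : F.
Hypothesis u_neq0 : u != 0.
Hypothesis u_aperiodic : forall n, u ^+ n.+1 != 1.

Lemma expu_inj m n : u ^+ m = u ^+ n -> m = n.
Proof.
wlog mn : m n / (m <= n)%N => [H E|].
  by case/orP: (leq_total m n) => mn; [|symmetry]; apply: H.
move=> E; apply/eqP; rewrite eqn_leq mn /= -subn_eq0.
have : u ^+ (n - m) == 1.
  by rewrite -(inj_eq (mulIf (expf_neq0 m u_neq0))) mul1r -exprD subnK // E.
by case: (n - m)%N => // k; rewrite (negPf (u_aperiodic k)).
Qed.

Lemma poly_eq_geom (p q : {poly F}) N :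
  (forall n, N <= n -> p.[u ^+ n.*2] = q.[u ^+ n.*2])%N -> p = q.
Proof.
move=> E; apply/eqP; rewrite -subr_eq0; apply/negPn/negP => pq0.
pose rs := [seq u ^+ (N + i).*2 | i <- iota 0 (size (p - q))].
have := @max_poly_roots _ _ rs pq0; rewrite size_map size_iota ltnn.
move=> H; have: false; last by []; apply: H.
  apply/allP => _ /mapP[i _ ->].
  by rewrite rootE hornerD hornerN E ?leq_addr // subrr.
rewrite map_inj_uniq ?iota_uniq // => i j /expu_inj; lia.
Qed.

(** A geometric sum of ratio u^(2k). *)
Lemma powsum_geom k n :
  (powsum F k.+1 n).@[@geom_pt _ u n]
  = - (brack u k.+1)^-1 * (1 - (u ^+ n.*2) ^+ k.+1).
Proof.
have b0 : brack u k.+1 != 0 by rewrite brack_neq0.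
rewrite /powsum rmorph_sum /=; apply: (mulfI b0).
rewrite mulrA mulrN divff // mulN1r opprB.
under eq_bigr do rewrite rmorphXn /= mevalXU.
elim: n => [|n IH]; first by rewrite big_ord0 mulr0 double0 expr0 expr1n subrr.
rewrite big_ord_recr mulrDr IH /geom_pt /= /brack -[u ^ (- _)]invr_expz -exprnP.
have uk : u ^+ k.+1 != 0 by rewrite expf_neq0.
rewrite -!exprM doubleS !mulSn !exprD.
by move: (u ^+ k.+1) (u ^+ (n.*2 * k.+1)) uk => A1 A2 A10; field.
Qed.

(** Along the evaluations at the first n odd powers of u, any polynomial P in the
    power sums that represents f becomes a polynomial in t = u^(2n), equal to g
    for infinitely many t.  At t = 0 the power sums are -1/[k]. *)
Lemma spec_eq (f : symfun F) (g : {poly F}) N :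
  (exists d (P : {mpoly F[d]}), forall n, f n = P \mPo powsums F d n) ->
  (forall n, N <= n -> (f n).@[@geom_pt _ u n] = g.[u ^+ n.*2])%N ->
  spec (fun k => - (brack u k)^-1) f = g.[0].
Proof.
move=> [d0 [P0 fP0]] fg.
have val d (P : {mpoly F[d]}) : (forall n, f n = P \mPo powsums F d n) ->
    P.@[fun k => - (brack u k.+1)^-1] = g.[0].
  move=> fP.
  pose h (k : 'I_d) : {poly F} := (- (brack u k.+1)^-1)%:P * (1 - 'X^(k.+1)).
  pose G := mmap (@polyC F) h P.
  have GE t : G.[t] = P.@[fun k => (h k).[t]].
    rewrite /G /mmap horner_sum mevalE; apply: eq_bigr => m _.
    by rewrite hornerM hornerC /mmap1 horner_prod; under eq_bigr do rewrite horner_exp.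
  have <- : G = g.
    apply: (poly_eq_geom (N := N)) => n /fg <-; rewrite fP comp_mpoly_meval GE.
    apply: meval_eq => k; rewrite tnth_mktuple powsum_geom /h.
    by rewrite hornerM hornerC hornerD hornerN hornerXn hornerC.
  rewrite GE; apply: meval_eq => k.
  by rewrite /h hornerM hornerC hornerD hornerN hornerXn hornerC expr0n subr0 mulr1.
rewrite /spec; apply: xget_unique => [|y [d [P [/val <- ->]]]] //.
by exists d0, P0; split => //; rewrite val.
Qed.

End Spec.

(** * The one-legged vertex *)

Lemma part_conj_eq0 (mu : part) : (part_conj mu == part0) = (mu == part0).
Proof.
apply/eqP/eqP => [/(congr1 (size \o val))|->]; last exact: val_inj.
rewrite /= size_mkseq => E; apply: val_inj; have := part_nth_gt0 mu 0.
by rewrite nth0 E ltnn lt0n size_eq0 => /esym/negbFE/eqP.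
Qed.

Lemma part_conj0 : part_conj part0 = part0.
Proof. by apply/eqP; rewrite part_conj_eq0. Qed.

Local Opaque schur.
Section Vertex.
Variable R : realType.
Local Notation K := (scalars R).
Local Notation qp := (qpow12 R).
Local Notation u := (qp 6).

Lemma tofracX_neq0 : tofrac ('X : {poly R[i]}) != 0.
Proof. by rewrite tofrac_eq0 polyX_eq0. Qed.

Lemma qpD a b : qp (a + b) = qp a * qp b.
Proof. by rewrite /qpow12 expfzDr // tofracX_neq0. Qed.

Lemma qp0 : qp 0 = 1.
Proof. by rewrite /qpow12 expr0z. Qed.

Lemma qp_neq0 a : qp a != 0.
Proof. by rewrite /qpow12 expfz_neq0 // tofracX_neq0. Qed.

Lemma qp_sum n (f : 'I_n -> int) : qp (\sum_(i < n) f i) = \prod_(i < n) qp (f i).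
Proof. exact: (big_morph _ qpD qp0). Qed.

Lemma qp6 k : qp (6 * k) = u ^ k.
Proof. by rewrite /qpow12 exprz_exp. Qed.

Lemma sqrtq_aperiodic n : u ^+ n.+1 != 1.
Proof.
rewrite /qpow12 -exprnP -exprM -rmorphXn -tofrac1 tofrac_eq.
apply/eqP => /(congr1 (fun p : {poly R[i]} => size p)).
by rewrite size_polyXn size_poly1 mulnS.
Qed.

Lemma scalars_char0 k : k.+1%:R != 0 :> K.
Proof.
rewrite -(rmorph_nat (@tofrac {poly R[i]})) tofrac_eq0 -polyC_natr polyC_eq0.
by rewrite pnatr_eq0.
Qed.

Lemma qintE k : qint R k = brack u k.
Proof. by rewrite /qint /brack -mulrN !qp6. Qed.

(** kappa is twice the sum of the contents. *)
Lemma prod_contents (mu : part) :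
  \prod_(i < size mu) \prod_(k < nth 0%N mu i) (- u ^ (i%:Z - k%:Z))
  = (-1) ^+ part_size mu * qp (- (3 * kappa mu)).
Proof.
have row (i m : nat) : \prod_(k < m) (- u ^ (i%:Z - k%:Z)) =
    (-1) ^+ m * qp (3 * (m%:Z * (2 * i.+1%:Z - 1 - m%:Z))).
  elim: m => [|m IH]; first by rewrite big_ord0 mul0r mulr0 qp0 mul1r.
  rewrite big_ord_recr IH /= -qp6 mulrN -mulrA -qpD exprS mulN1r mulNr.
  by congr (- (_ * qp _)); lia.
under eq_bigr do rewrite row.
rewrite big_split /= -qp_sum -mulrN; congr (_ * qp _).
  rewrite /part_size sumnE (big_nth 0%N) big_mkord.
  by rewrite (big_morph _ (exprD (-1)) (expr0 (-1))).
rewrite /kappa -sumrN mulr_sumr; apply: eq_bigr => i _; lia.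
Qed.

Lemma spec_schur (mu : part) : spec_qmrho (schur K mu) =
  weight u (levels mu (size mu)) * ((-1) ^+ part_size mu * qp (- (3 * kappa mu))).
Proof.
rewrite /spec_qmrho.
have -> : (fun k => - (qint R k)^-1) = (fun k : nat => - (brack u k)^-1).
  by apply/funext => k; rewrite qintE.
rewrite (@spec_eq _ u (qp_neq0 6) sqrtq_aperiodic _ (schur_geom_poly u mu) (size mu)).
- rewrite -prod_contents /schur_geom_poly hornerM hornerC; congr (_ * _).
  rewrite horner_prod; apply: eq_bigr => i _; rewrite horner_prod.
  by apply: eq_bigr => k _; rewrite hornerZ hornerD hornerN hornerZ hornerX hornerC mulr0 subr0 mulr1.
- exact: (schur_powsums scalars_char0).
- by move=> n; apply: schur_geom; [exact: qp_neq0|exact: sqrtq_aperiodic].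
Qed.

Lemma spec_zero : spec_qmrho (fun=> 0 : {mpoly K[_]}) = 0.
Proof.
rewrite /spec_qmrho.
have -> : (fun k => - (qint R k)^-1) = (fun k : nat => - (brack u k)^-1).
  by apply/funext => k; rewrite qintE.
rewrite (@spec_eq _ u (qp_neq0 6) sqrtq_aperiodic _ 0 0) ?horner0 //.
  by exists 0%N, 0 => n; rewrite comp_mpoly0.
by move=> n _; rewrite meval0 horner0.
Qed.

Lemma kappa0 : kappa part0 = 0.
Proof. by rewrite /kappa big_ord0. Qed.

Lemma spec_schur0 : spec_qmrho (schur K part0) = 1.
Proof.
rewrite spec_schur kappa0 (mulr0 3) oppr0 qp0 mulr1.
by rewrite (@weight_levels0 _ u (qp_neq0 6) sqrtq_aperiodic) mul1r expr0.
Qed.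

Lemma W2_part0l (mu : part) :
  W2 R part0 mu = qp (3 * kappa mu) * weight u (levels mu (size mu)).
Proof.
rewrite /W2 (fsbigTE [fset part0]%fset) => [|eta]; last first.
  by rewrite inE => eta0; rewrite skew_schur_part0l // spec_zero mul0r.
rewrite big_seq_fset1 !skew_schur_part0r spec_schur0 mul1r spec_schur kappa0 add0r.
have -> : 6 * kappa mu = 3 * kappa mu + 3 * kappa mu by ring.
have qq : qp (3 * kappa mu) * qp (- (3 * kappa mu)) = 1 by rewrite -qpD subrr qp0.
have sgn : (-1) ^+ part_size mu * (-1) ^+ part_size mu = 1 :> K.
  by rewrite -exprD addnn -signr_odd odd_double.
rewrite add0n qpD; move: (weight _ _) => w; move: qq sgn.
move: (qp _) (qp _) ((-1) ^+ _) => A2 A1 A3 qq sgn.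
by transitivity (A1 * w * (A1 * A2) * (A3 * A3)); [ring|rewrite qq sgn !mulr1].
Qed.

(** Only eta = tau = 0 and la = mu contribute. *)
Lemma W3_one_leg (mu : part) : W3 R mu part0 part0 = W2 R part0 mu.
Proof.
have LR_sum (lt : part * part) :
    \sum_(eta \in [set: part]) LR K mu eta lt.1 * LR K part0 eta (part_conj lt.2)
    = (lt == (mu, part0))%:R.
  rewrite (fsbigTE [fset part0]%fset) => [|eta]; last first.
    by rewrite inE LR_part0 => /negPf ->; rewrite mulr0.
  rewrite big_seq_fset1 LR_part0 LR_part0l eqxx part_conj_eq0 -natrM mulnb.
  by case: lt => la tau /=; rewrite xpair_eqE eq_sym.
rewrite /W3 !part_conj0 (fsbigTE [fset (mu, part0)]%fset) => [|lt]; last first.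
  by rewrite inE LR_sum => /negPf ->; rewrite !mul0r.
rewrite big_seq_fset1 LR_sum eqxx mul1r kappa0 (mulr0 6) addr0 qp0 mul1r part_conj0.
rewrite mulfK // W2_part0l kappa0 (mulr0 3) qp0 mul1r.
by rewrite (@weight_levels0 _ u (qp_neq0 6) sqrtq_aperiodic) oner_neq0.
Qed.

Lemma framed_vertex_one_leg a (mu : part) : framed_vertex R a 0 0 mu part0 part0 =
  qp (3 * (2 * a + 1) * kappa mu) * weight u (levels mu (size mu)).
Proof.
rewrite /framed_vertex W3_one_leg W2_part0l kappa0 mulrA -qpD.
by congr (qp _ * _); ring.
Qed.

End Vertex.

(** * Partial fractions and the motion of one particle *)

(** Lagrange interpolation of f at the nodes z b, divided by the polynomial
    vanishing at these nodes. *)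
Lemma lagrange_partial_fraction (F : fieldType) n (z : 'I_n -> F) (f : {poly F}) x :
  injective z -> (size f <= n)%N -> (forall b, x != z b) ->
  f.[x] / \prod_b (x - z b)
  = \sum_b f.[z b] / ((x - z b) * \prod_(b' | b' != b) (z b - z b')).
Proof.
move=> z_inj sf xz.
pose w b := \prod_(b' | b' != b) (z b - z b').
have w0 b : w b != 0.
  by apply/prodf_neq0 => b' b'b; rewrite subr_eq0 (inj_eq z_inj) eq_sym.
pose l b : {poly F} := \prod_(b' | b' != b) ('X - (z b')%:P).
have lE b y : (l b).[y] = \prod_(b' | b' != b) (y - z b').
  by rewrite horner_prod; apply: eq_bigr => b' _; rewrite hornerXsubC.
pose p := f - \sum_b (f.[z b] / w b) *: l b.
have p0 : p = 0.
  apply/eqP/negPn/negP => pn0.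
  have := max_poly_roots pn0 (rs := codom z); rewrite size_codom card_ord => H.
  have : (n < size p)%N.
    apply: H; last exact/injectiveP.
    apply/allP => _ /codomP[b ->]; rewrite rootE /p hornerD hornerN horner_sum.
    rewrite (bigD1 b) //= big1 ?addr0 => [|b' b'b].
      by rewrite hornerZ lE divfK // subrr.
    by rewrite hornerZ lE (bigD1 b) 1?eq_sym //= subrr mul0r mulr0.
  rewrite ltnNge; apply/negP/negPn.
  rewrite /p; apply: leq_trans (size_polyD _ _) _; rewrite geq_max sf size_polyN.
  apply: leq_trans (size_sum _ _ _) _; apply/bigmax_leqP => b _.
  apply: leq_trans (size_scale_leq _ _) _.
  apply: leq_trans (size_poly_prod_leq _ _) _.
  under eq_bigr do rewrite size_XsubC.
  by rewrite sum_nat_const cardC1 card_ord; have := ltn_ord b; lia.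
have : f.[x] = \sum_b f.[z b] / w b * (l b).[x].
  move/eqP: p0; rewrite subr_eq0 => /eqP fE; rewrite {1}fE horner_sum.
  by apply: eq_bigr => b _; rewrite hornerZ.
move=> ->; rewrite mulr_suml; apply: eq_bigr => b _.
have xb0 b' : x - z b' != 0 by rewrite subr_eq0.
have lx0 : (l b).[x] != 0 by rewrite lE; apply/prodf_neq0.
rewrite (bigD1 b) //= -lE -/(w b).
by field; rewrite lx0 xb0 w0.
Qed.

Section OneParticle.
Variable F : fieldType.
Variable u : F.
Hypothesis u_neq0 : u != 0.
Hypothesis u_aperiodic : forall n, u ^+ n.+1 != 1.

Lemma prod_brack_below a n : (n <= a)%N ->
  \prod_(b < n) brack u (a%:Z - b%:Z) * bfact u (a - n) = bfact u a.
Proof.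
elim: n => [|n IH] na; first by rewrite big_ord0 mul1r subn0.
rewrite big_ord_recr -IH ?(ltnW na) //= -mulrA; congr (_ * _).
by rewrite -(subnSK na) bfactS mulrC; congr (_ * brack u _); lia.
Qed.

Lemma prod_brack_others L (b : 'I_L.+1) :
  \prod_(b' < L.+1 | b' != b) brack u (b%:Z - b'%:Z)
  = (-1) ^+ (L - b) * bfact u b * bfact u (L - b).
Proof.
pose f b' := brack u (b%:Z - b'%:Z).
rewrite (bigID (fun b' : 'I_L.+1 => b' < b)%N) /=.
have -> : \prod_(i < L.+1 | (i != b) && (i < b)%N) f i = bfact u b.
  rewrite -[RHS](prod_brack_below (leqnn b)) subnn bfact0 mulr1.
  rewrite (big_ord_widen L.+1 f (ltnW (ltn_ord b))); apply: eq_bigl => i.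
  by rewrite -val_eqE ltn_neqAle; case: eqP.
have -> : \prod_(i < L.+1 | (i != b) && ~~ (i < b)%N) f i
        = \prod_(j < L - b) (- brack u j.+1).
  rewrite -(big_mkord (fun i => (i != b) && ~~ (i < b)%N) f).
  rewrite (big_cat_nat (n := b.+1)) //= big_nat_cond big1 ?mul1r => [|i]; last first.
    by move=> /andP[/andP[_ ib]]; move: ib; rewrite ltnS leq_eqVlt => /orP[->|->] //;
       rewrite andbF.
  rewrite -{1}(add0n b.+1) big_addn subSS big_mkord; apply: eq_big => [i|i _]; first lia.
  by rewrite -brackN /f; congr (brack u _); lia.
rewrite prodrN card_ord mulrCA mulrA; congr (_ * _).
by rewrite /bfact big_add1 big_mkord.
Qed.

(** Since [x - y] = u^(-x-y) (u^(2x) - u^(2y)), this is the partial fraction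
    expansion at the nodes u^0, u^2, ..., u^(2L).  The powers of u can be
    factored out because each term on either side has one more bracket in its
    denominator than in its numerator. *)
Lemma brack_interpolation (D : seq nat) (L a : nat) :
  size D = L -> (L < a)%N ->
  \prod_(c <- D) brack u (a%:Z - c%:Z) / \prod_(b < L.+1) brack u (a%:Z - b%:Z)
  = \sum_(b < L.+1) \prod_(c <- D) brack u (b%:Z - c%:Z) /
      (brack u (a%:Z - b%:Z) * \prod_(b' < L.+1 | b' != b) brack u (b%:Z - b'%:Z)).
Proof.
move=> sD La; pose z (c : nat) := u ^+ c.*2; pose v (c : nat) := (u ^+ c)^-1.
have v0 c : v c != 0 by rewrite invr_eq0 expf_neq0.
have bE (x y : nat) : brack u (x%:Z - y%:Z) = v x * v y * (z x - z y).
  rewrite brackB // opprD expfzDr // /v /z !exprnP !invr_expz.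
  by rewrite -!mul2n !PoszM.
have z_inj : injective z by move=> x y /(expu_inj u_neq0 u_aperiodic) /double_inj.
pose f := \prod_(c <- D) ('X - (z c)%:P).
have fE y : f.[y] = \prod_(c <- D) (y - z c).
  by rewrite horner_prod; apply: eq_bigr => c _; rewrite hornerXsubC.
have pf : f.[z a] / \prod_(b < L.+1) (z a - z b) = \sum_(b < L.+1) f.[z b] /
    ((z a - z b) * \prod_(b' < L.+1 | b' != b) (z b - z b')).
  apply: (@lagrange_partial_fraction _ _ (fun b : 'I_L.+1 => z b)).
  - by move=> x y /z_inj/val_inj.
  - by rewrite size_prod_XsubC sD.
  - by move=> b; apply/eqP => /z_inj; have := ltn_ord b; lia.
(* the powers of u factored out of the products over D and over the nodes *)
pose V := \prod_(c <- D) v c; pose W := \prod_(b < L.+1) v b.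
have V0 : V != 0 by rewrite prodf_seq_neq0; apply/allP => c _; rewrite v0.
have W0 : W != 0 by apply/prodf_neq0 => b _; rewrite v0.
have DE x : \prod_(c <- D) brack u (x%:Z - c%:Z) = v x ^+ L * V * f.[z x].
  rewrite fE -sD /V; elim: (D) => [|c s IH]; first by rewrite !big_nil expr0 !mulr1.
  by rewrite !big_cons IH bE /= exprS; ring.
have LE x : \prod_(b < L.+1) brack u (x%:Z - b%:Z)
          = v x ^+ L.+1 * W * \prod_(b < L.+1) (z x - z b).
  rewrite -[L.+1 in X in X * W]card_ord -prodr_const -!big_split /=.
  by apply: eq_bigr => c _; rewrite bE.
have LE' (b : 'I_L.+1) : \prod_(b' < L.+1 | b' != b) brack u (b%:Z - b'%:Z)
    = v b ^+ L * (W / v b) * \prod_(b' < L.+1 | b' != b) (z b - z b').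
  have -> : W / v b = \prod_(b' < L.+1 | b' != b) v b'.
    by rewrite /W (bigD1 b) //= mulrC mulKf.
  have -> : v b ^+ L = \prod_(b' < L.+1 | b' != b) v b.
    by rewrite prodr_const cardC1 card_ord.
  by rewrite -!big_split /=; apply: eq_bigr => c _; rewrite bE.
transitivity (V / (W * v a) * (f.[z a] / \prod_(b < L.+1) (z a - z b))).
  have P0 : \prod_(b < L.+1) (z a - z b) != 0.
    apply/prodf_neq0 => b _; rewrite subr_eq0; apply/eqP => /z_inj.
    by have := ltn_ord b; lia.
  rewrite DE LE exprS; set A := v a ^+ L; have A0 : A != 0 by rewrite expf_neq0.
  by field; rewrite P0 A0 W0 v0.
rewrite pf mulr_sumr; apply: eq_bigr => b _; rewrite DE LE' bE.
have P0 : \prod_(b' < L.+1 | b' != b) (z b - z b') != 0.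
  apply/prodf_neq0 => b' /negP b'b; rewrite subr_eq0; apply/eqP => /z_inj E.
  by apply: b'b; apply/eqP/val_inj.
have Q0 : z a - z b != 0.
  by rewrite subr_eq0; apply/eqP => /z_inj; have := ltn_ord b; lia.
set A := v b ^+ L; have A0 : A != 0 by rewrite expf_neq0.
by field; rewrite P0 A0 W0 Q0 !v0.
Qed.

(** The sign picked up when x is inserted in or removed from the wedge of D. *)
Definition above_sign (x : nat) (D : seq nat) : F :=
  \prod_(c <- D | (x < c)%N) -1.

Lemma above_sign_sqr x D : above_sign x D * above_sign x D = 1.
Proof.
by rewrite /above_sign -big_split /= big1 // => c _; rewrite mulrNN mulr1.
Qed.

Lemma vdm_cons x (D : seq nat) : x \notin D ->
  vdm u (x :: D) = above_sign x D * \prod_(c <- D) brack u (x%:Z - c%:Z) * vdm u D.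
Proof.
move=> xD; rewrite /vdm big_cons big_cons ltnn.
have -> : \prod_(a <- D) \prod_(b <- x :: D | (b < a)%N) brack u (a%:Z - b%:Z) =
    \prod_(a <- D | (x < a)%N) brack u (a%:Z - x%:Z) * vdm u D.
  rewrite /vdm [X in X * _]big_mkcond -big_split /=; apply: eq_bigr => a _; rewrite big_cons.
  by case: ifP => //; rewrite mul1r.
rewrite mulrA; congr (_ * _).
rewrite /above_sign !(big_mkcond (fun c => _ < _)%N) -!big_split /=.
rewrite !big_seq; apply: eq_bigr => c cD; case: (ltngtP x c) => [||xc].
- by rewrite mul1r mulN1r -brackN opprB.
- by rewrite !(mulr1, mul1r).
- by rewrite xc cD in xD.
Qed.

Lemma weight_cons x (D : seq nat) : x \notin D ->
  weight u (x :: D) = above_sign x D * \prod_(c <- D) brack u (x%:Z - c%:Z) / bfact u x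
                    * weight u D.
Proof.
move=> xD; rewrite /weight vdm_cons // big_cons.
have b0 := bfact_neq0 u_neq0 u_aperiodic x.
by have P0 := prod_bfact_neq0 u_neq0 u_aperiodic D; field; rewrite b0 P0.
Qed.

(** The last particle that was moved to the level a may come from any vacant
    level b below L + 1.  The signs of the wedges turn the products of positive
    brackets in the weights into the signed products of [brack_interpolation],
    where occupied levels b contribute 0. *)
Lemma weight_expansion (D : seq nat) (L a : nat) :
  size D = L -> (L < a)%N -> a \notin D ->
  weight u (a :: D) = \sum_(b <- iota 0 L.+1 | b \notin D)
    (-1) ^+ (L - b) / (brack u (a%:Z - b%:Z) * bfact u (a - L.+1) * bfact u (L - b))
    * (above_sign a D * above_sign b D) * weight u (b :: D).
Proof.
move=> sD La aD.
have bf0 := bfact_neq0 u_neq0 u_aperiodic.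
have -> : weight u (a :: D) = above_sign a D * weight u D / bfact u (a - L.+1) *
   (\prod_(c <- D) brack u (a%:Z - c%:Z) / \prod_(b < L.+1) brack u (a%:Z - b%:Z)).
  rewrite weight_cons // -(prod_brack_below La) invfM; ring.
rewrite brack_interpolation // mulr_sumr -[iota _ _]/(index_iota 0 L.+1) big_mkord.
rewrite [RHS]big_mkcond /=; apply: eq_bigr => b _.
case: ifPn => [bD|]; last first.
  by rewrite negbK => bD; rewrite (big_rem _ bD) /= subrr /brack subrr !(mul0r, mulr0).
rewrite weight_cons // prod_brack_others.
rewrite !invfM invr_sign -[LHS]mulr1 -(above_sign_sqr b D); ring.
Qed.

End OneParticle.

(** * Wedges as finite sets of levels *)

Lemma adm_ext (A B : admissible) : (forall r, adm_set A r <-> adm_set B r) -> A = B.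
Proof.
case: A B => [A pA] [B pB] /= AB.
have E : A = B by apply/seteqP; split=> r /AB.
by case: _ / E pB => pB; congr Admissible; exact: Prop_irrelevance.
Qed.

(** The wedge that contains everything below -L and the elements of S shifted
    by -L. *)
Definition sea_set (L : nat) (S : {fset nat}) : set int :=
  [set r | (r < - L%:Z) || (absz (r + L%:Z) \in S)].

Lemma sea_subproof L S : is_admissible (sea_set L S).
Proof.
split.
  apply: (@sub_finite_set _ _ ((fun a : nat => a%:Z - L%:Z) @` [set` S])).
    move=> r /= [/orP[|rS] r0]; first by lia.
    by exists (absz (r + L%:Z)); rewrite //=; lia.
  exact/finite_image/finite_fset.
apply: (@sub_finite_set _ _ ((fun a : nat => - a%:Z) @` `I_L.+1)).
  move=> r /= [r0 /negP]; rewrite negb_or => /andP[rL _].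
  by exists (absz r); rewrite /=; lia.
exact/finite_image/finite_II.
Qed.

Definition sea L S : admissible := Admissible (sea_subproof L S).

Lemma seaE L S r : (r \in adm_set (sea L S)) = (r < - L%:Z) || (absz (r + L%:Z) \in S).
Proof. by apply/idP/idP; rewrite inE. Qed.

(** L bounds the absolute values of all negative holes of B. *)
Lemma seaP (B : admissible) : exists L S, B = sea L S.
Proof.
have [fp fn] := admP B.
pose X := fset_set [set r : int | r < 0 /\ ~ adm_set B r].
pose L := (\sum_(r <- X) absz r)%N.
have deep r : r < - L%:Z -> adm_set B r.
  move=> rL; apply: contrapT => nBr.
  have rX : r \in X.
    by rewrite in_fset_set // inE; split => //; lia.
  by move: rL; rewrite /L (big_fsetD1 r) //=; lia.
have finW : finite_set [set a : nat | adm_set B (a%:Z - L%:Z)].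
  apply: (@sub_finite_set _ _ (`I_L `|` (fun r => absz (r + L%:Z)) @`
      [set r : int | adm_set B r /\ 0 <= r])).
    move=> a /= Ba; case: (ltnP a L) => aL; [by left|right].
    by exists (a%:Z - L%:Z); [split => //|]; lia.
  by rewrite finite_setU; split; [exact: finite_II|exact: finite_image].
exists L, (fset_set [set a : nat | adm_set B (a%:Z - L%:Z)]).
apply: adm_ext => r /=; split => [Br|/orP[/deep//|]].
  apply/orP; case: (ltrP r (- L%:Z)) => rL; [by left|right].
  by rewrite in_fset_set // inE /= (_ : _ - _ = r) //; lia.
case: (ltrP r (- L%:Z)) => rL; first by move=> _; exact: deep.
by rewrite in_fset_set // inE /= (_ : _ - _ = r) //; lia.
Qed.

Lemma sea_inj L S T : sea L S = sea L T -> S = T.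
Proof.
move=> E; apply/fsetP => a.
have := congr1 (fun A : admissible => (a%:Z - L%:Z) \in adm_set A) E.
rewrite /= !seaE (_ : a%:Z - L%:Z < - L%:Z = false); last by lia.
by rewrite (_ : absz _ = a); last by lia.
Qed.

Lemma sea_del L S a : adm_del (sea L S) (a%:Z - L%:Z) = sea L (S `\ a)%fset.
Proof.
apply: adm_ext => r; rewrite /= /sea_set /= !inE.
case: (ltrP r (- L%:Z)) => rL /=; first by split => // _; split => //; lia.
split=> [[rS ra]|/andP[/eqP ra rS]].
  by rewrite rS andbT; apply/eqP => E; apply: ra; lia.
by split => // E; apply: ra; lia.
Qed.

Lemma sea_add L S a : adm_add (sea L S) (a%:Z - L%:Z) = sea L (a |` S)%fset.
Proof.
apply: adm_ext => r; rewrite /= /sea_set /= !inE.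
case: (ltrP r (- L%:Z)) => rL /=; first by split => // _; left.
split=> [[-> |E]|/orP[/eqP E|->]]; rewrite ?orbT //; last by left.
  by apply/orP; left; lia.
by right; lia.
Qed.

Lemma above_sea L S a :
  [set s : int | adm_set (sea L S) s /\ a%:Z - L%:Z < s]
  = (fun c : nat => c%:Z - L%:Z) @` [set` [fset c in S | (a < c)%N]%fset].
Proof.
apply/seteqP; split=> s /=.
  move=> [/orP[|sS] sa]; first by lia.
  by exists (absz (s + L%:Z)); rewrite ?inE ?sS /=; lia.
move=> [c]; rewrite !inE /= => /andP[cS ac] <-; split; last by lia.
by apply/orP; right; rewrite (_ : absz _ = c) //; lia.
Qed.

Lemma card_above L S a :
  #|` fset_set [set s : int | adm_set (sea L S) s /\ a%:Z - L%:Z < s]|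
  = #|` [fset c in S | (a < c)%N]%fset|.
Proof.
rewrite above_sea fset_set_image; last exact: finite_fset.
by rewrite set_fsetK card_imfset //= => x y; lia.
Qed.

Lemma card_from L S a : a \in S ->
  #|` fset_set [set s : int | adm_set (sea L S) s /\ a%:Z - L%:Z <= s]|
  = #|` [fset c in S | (a < c)%N]%fset|.+1.
Proof.
move=> aS; rewrite -(card_above L).
have -> : [set s : int | adm_set (sea L S) s /\ a%:Z - L%:Z <= s]
  = (a%:Z - L%:Z) |` [set s : int | adm_set (sea L S) s /\ a%:Z - L%:Z < s].
  apply/seteqP; split=> s /=.
    by rewrite le_eqVlt => -[As /orP[/eqP|]]; [left|right].
  move=> [->|[As /ltW]] //; split => //; apply/orP; right.
  by rewrite (_ : absz _ = a) //; lia.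
have fin : finite_set [set s : int | adm_set (sea L S) s /\ a%:Z - L%:Z < s].
  by rewrite above_sea; exact/finite_image/finite_fset.
by rewrite fset_setU1 // cardfsU1 in_fset_set // memNset //= => -[_]; rewrite ltxx.
Qed.

Section Fock.
Variable K : fieldType.

Lemma above_signE a (S : {fset nat}) :
  above_sign K a S = (-1) ^+ #|` [fset c in S | (a < c)%N]%fset|.
Proof.
have -> : #|` [fset c in S | (a < c)%N]%fset| = count (fun c => a < c)%N S.
  rewrite -size_filter; apply/perm_size/uniq_perm; rewrite ?filter_uniq ?fset_uniq //.
  by move=> c; rewrite mem_filter !inE andbC.
rewrite /above_sign big_const_seq.
by elim: (count _ _) => [|n IH]; rewrite ?expr0 // exprS -IH.
Qed.

(** psi_r reaches the wedge of S from a single wedge, that of S without r. *)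
Lemma psi_sea (f : fock K) L S a : psi (a%:Z - L%:Z) f (sea L S) =
  if a \in S then above_sign K a (S `\ a)%fset * f (sea L (S `\ a)%fset) else 0.
Proof.
rewrite /psi /lin_ext; set r := a%:Z - L%:Z.
have rE : (r \in adm_set (sea L S)) = (a \in S).
  by rewrite seaE (_ : absz _ = a) ?/r; [case: (_ \in _); lia|lia].
rewrite -sea_del -/r; set B := sea L S in rE *.
have out A : A != adm_del B r \/ a \notin S -> psi_wedge K r A B = 0.
  move=> H; rewrite /psi_wedge /wedge; case: ifPn => // rA; case: eqP => [E|]; last by rewrite mulr0.
  exfalso; case: H => [/eqP[]|].
    apply: adm_ext => s; rewrite E /=; split => [As|[[]] //].
    by split; [left|move=> sr; move: rA; rewrite -sr mem_set].
  by rewrite -rE E => /negP; apply; rewrite inE /=; right.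
case: ifPn => aS; last by apply: fsbig1 => A _; rewrite out ?mulr0 //; right.
rewrite (fsbigTE [fset adm_del B r]%fset) => [|A]; last first.
  by rewrite inE => AB; rewrite out ?mulr0 //; left.
rewrite big_seq_fset1 mulrC /psi_wedge ifN; last first.
  by apply/negP; rewrite inE /= => -[].
have -> : adm_add (adm_del B r) r = B.
  apply: adm_ext => s /=; split; first by case=> [[]//|->]; rewrite -rE inE in aS.
  by case: (eqVneq s r) => [|/eqP]; [right|left].
by rewrite /wedge eqxx mulr1 /B /r sea_del card_above -above_signE.
Qed.

Lemma psi_star_sea (f : fock K) L S b : psi_star (b%:Z - L%:Z) f (sea L S) =
  if b \in S then 0 else above_sign K b S * f (sea L (b |` S)%fset).
Proof.
rewrite /psi_star /lin_ext; set r := b%:Z - L%:Z.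
have rE : (r \in adm_set (sea L S)) = (b \in S).
  by rewrite seaE (_ : absz _ = b) ?/r; [case: (_ \in _); lia|lia].
rewrite -sea_add -/r; set B := sea L S in rE *.
have out A : A != adm_add B r \/ b \in S -> psi_star_wedge K r A B = 0.
  move=> H; rewrite /psi_star_wedge /wedge; case: ifPn => // rA; case: eqP => [E|]; last by rewrite mulr0.
  exfalso; case: H => [/eqP[]|].
    apply: adm_ext => s; rewrite E /=; split => [As|[[]//|->]]; last by rewrite inE in rA.
    by case: (eqVneq s r) => [|/eqP]; [right|left].
  by rewrite -rE E inE /= => -[].
case: ifPn => bS; first by apply: fsbig1 => A _; rewrite out ?mulr0 //; right.
rewrite (fsbigTE [fset adm_add B r]%fset) => [|A]; last first.
  by rewrite inE => AB; rewrite out ?mulr0 //; left.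
rewrite big_seq_fset1 mulrC /psi_star_wedge ifT; last by rewrite inE /=; right.
have -> : adm_del (adm_add B r) r = B.
  apply: adm_ext => s /=; split; first by case=> -[].
  move=> Bs; split; first by left.
  by move=> sr; move: bS; rewrite -rE -sr mem_set.
rewrite /wedge eqxx mulr1 /B /r sea_add card_from ?fset1U1 // addn1 !exprS mulN1r mulN1r opprK.
rewrite above_signE; congr (_ ^+ #|` _| * _); apply/fsetP => c; rewrite !inE /=.
by case: eqP => [->|] //=; rewrite ltnn andbF.
Qed.

Lemma psi_star_deep (f : fock K) L S r : r < - L%:Z -> psi_star r f (sea L S) = 0.
Proof.
move=> rL; apply: fsbig1 => A _; rewrite /psi_star_wedge /wedge; case: ifPn; last by rewrite mulr0.
move=> rA; case: eqP => [E|]; last by rewrite !mulr0.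
exfalso; have : (r \in adm_set (sea L S)) by rewrite seaE rL.
by rewrite E inE /= => -[].
Qed.

(** A bilinear reaching the wedge of S filled the level a = m + L of S after
    emptying the level b = L - n - 1, which is thus vacant in S. *)
Lemma bilinear_sea (A : nat -> nat -> K) (f : fock K) L S :
  bilinear_op A f (sea L S) =
  \sum_(a <- S | (L <= a)%N) \sum_(b <- iota 0 L | b \notin (S `\ a)%fset)
    A (a - L)%N (L - b.+1)%N *
    (above_sign K a (S `\ a)%fset * above_sign K b (S `\ a)%fset) *
    f (sea L (b |` (S `\ a))%fset).
Proof.
rewrite /bilinear_op.
pose r1 := [seq (a - L)%N | a <- S & (L <= a)%N].
pose r2 := [seq (L - b.+1)%N | b <- iota 0 L].
pose r := [seq (m, n) | m <- r1, n <- r2].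
have mE a : (L <= a)%N -> (a - L)%:Z = a%:Z - L%:Z by move=> La; lia.
have nE b : (b < L)%N -> - (L - b.+1)%:Z - 1 = b%:Z - L%:Z by move=> bL; lia.
have ur : uniq r.
  apply: allpairs_uniq; last by move=> [? ?] [? ?].
    rewrite map_inj_in_uniq ?filter_uniq ?fset_uniq // => a a'.
    by rewrite !mem_filter => /andP[La _] /andP[La' _]; lia.
  by rewrite map_inj_in_uniq ?iota_uniq // => b b'; rewrite !mem_iota; lia.
rewrite (fsbigE r) //; last first.
  case=> m n _ mnr /=.
  rewrite (_ : m%:Z = (m + L)%:Z - L%:Z); last by lia.
  rewrite psi_sea; case: ifPn => mS; last by rewrite mulr0.
  have [nL|Ln] := ltnP n L; last by rewrite psi_star_deep ?mulr0 //; lia.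
  case/negP: mnr; apply/allpairsP; exists (m, n); split => //=; apply/mapP.
    by exists (m + L)%N; rewrite ?mem_filter ?mS ?leq_addl ?addnK.
  by exists (L - n.+1)%N; rewrite ?mem_iota; lia.
rewrite (eq_bigl predT) => [|mn]; last by rewrite in_setT.
rewrite big_allpairs big_map big_filter [LHS]big_seq_cond [RHS]big_seq_cond.
apply: eq_bigr => a /andP[aS La]; rewrite big_map [RHS]big_mkcond [LHS]big_seq [RHS]big_seq.
apply: eq_bigr => b; rewrite mem_iota /= => bL.
rewrite mE // nE // psi_sea aS psi_star_sea; case: (b \in _); first by rewrite !mulr0.
by rewrite /= !mulrA.
Qed.

Lemma vacuum_sea L : maya part0 = sea L [fset c | c in iota 0 L]%fset.
Proof.
apply: adm_ext => r; rewrite /= /maya_set /sea_set /=; split.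
  move=> [i _ <-]; rewrite nth_nil; apply/orP; rewrite inE mem_iota /=; lia.
move=> H; exists (absz r).-1 => //; rewrite nth_nil.
by case/orP: H; rewrite ?inE ?mem_iota /=; lia.
Qed.

End Fock.

Lemma perm_fsetU1 (x : nat) (D : {fset nat}) :
  x \notin D -> perm_eq (x |` D)%fset (x :: D).
Proof.
move=> xD; apply: uniq_perm; rewrite /= ?fset_uniq ?xD // => c.
by rewrite !inE.
Qed.

Lemma levels_sorted (mu : part) n : sorted gtn (levels mu n).
Proof.
rewrite /levels /mkseq; apply: (@homo_sorted_in _ _ (fun i => (i < n)%N) _ ltn).
- by move=> i j _ jn /= ij; apply: level_lt; rewrite ij.
- by apply/allP => i; rewrite mem_iota.
- exact: iota_ltn_sorted.
Qed.

Lemma levels_uniq (mu : part) n : uniq (levels mu n).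
Proof.
apply: sorted_uniq (levels_sorted mu n).
  by move=> x y z /= yx zy; exact: ltn_trans zy yx.
by move=> x /=; rewrite ltnn.
Qed.

Lemma levels0_perm n : perm_eq (levels part0 n) (iota 0 n).
Proof.
apply: uniq_perm; rewrite ?levels_uniq ?iota_uniq // => x.
rewrite mem_iota; apply/mapP/idP => [[j]|xn].
  by rewrite mem_iota /level nth_nil => /andP[_ i_lt] ->; lia.
by exists (n - x.+1)%N; rewrite ?mem_iota /level ?nth_nil; lia.
Qed.

(** * The exponential applied to the vacuum *)

Section Exponential.
Variables (R : realType) (a : int).
Local Notation K := (scalars R).
Local Notation qp := (qpow12 R).
Local Notation u := (qp 6).

(** The sum of r (r + 1) = (r + 1/2)^2 - 1/4 over the elements r of the wedge;
    its excess over the vacuum is kappa. *)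
Definition energy (L : nat) (S : seq nat) : int :=
  \sum_(c <- S) (c%:Z - L%:Z) * (c%:Z - L%:Z + 1).

Definition sea_coef (L : nat) (S : seq nat) : K :=
  qp (3 * (2 * a + 1) * (energy L S - energy L (iota 0 L))) * weight u S.

Lemma sea_coef_perm L S T : perm_eq S T -> sea_coef L S = sea_coef L T.
Proof. by move=> ST; rewrite /sea_coef /energy (perm_big _ ST) (weight_perm _ ST). Qed.

Lemma qfactE n : qfact R n = bfact u n.
Proof. by apply: eq_bigr => k _; rewrite qintE. Qed.

(** The power of q in [Acoef] is the change of the energy when a particle moves
    from b to x, since (m - n)(m + n + 1) = m (m + 1) - n (n + 1). *)
Lemma sea_coef_expansion (D : seq nat) (L x : nat) : (size D).+1 = L -> (L <= x)%N ->
  x \notin D ->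
  \sum_(b <- iota 0 L | b \notin D) Acoef R a (x - L) (L - b.+1)
     * (above_sign K x D * above_sign K b D) * sea_coef L (b :: D)
  = sea_coef L (x :: D).
Proof.
case: L => // L [sD] Lx xD; rewrite /sea_coef.
rewrite (weight_expansion (qp_neq0 R 6) (@sqrtq_aperiodic R) sD Lx xD) mulr_sumr.
rewrite !(big_seq_cond (fun b => b \notin D)); apply: eq_bigr => b /andP[bI bD].
have bL : (b <= L)%N by rewrite mem_iota in bI.
rewrite /Acoef !qfactE qintE subSS.
rewrite /energy; set E0 := \sum_(_ <- iota _ _) _; rewrite !big_cons.
set E := \sum_(_ <- D) _.
rewrite (_ : (x - L.+1 + (L - b) + 1)%:Z = x%:Z - b%:Z); last by lia.
set e := 3 * _; set e' := 3 * _ * _; set e'' := 3 * _ * _.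
have -> : e'' = e + e'.
  rewrite /e /e' /e''.
  have -> : (x - L.+1)%:Z = x%:Z - L%:Z - 1 by lia.
  have -> : (L - b)%:Z = L%:Z - b%:Z by lia.
  rewrite !(intS L); ring.
rewrite (qpD R e); move: (qp e) (qp e') (weight _ _) (above_sign _ _ _) (above_sign _ _ _) => A1 A2 A3 A4 A5.
move: ((-1) ^+ _) (_^-1) => A6 A7; ring.
Qed.

(** The number of occupied levels that are vacant in the vacuum. *)
Definition particles (L : nat) (S : seq nat) : nat := count (fun c => L <= c)%N S.

(** Each application of the bilinear operator moves one particle from a
    negative to a nonnegative level.  By [sea_coef_expansion] each of the k + 1
    particles, taken as the last one moved, contributes k! times the same value. *)
Lemma iter_bilinear L k (S : {fset nat}) :
  iter k (bilinear_op (Acoef R a)) (ket K part0) (sea L S) =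
  if (#|` S| == L) && (particles L S == k) then k`!%:R * sea_coef L S else 0.
Proof.
elim: k S => [|k IH] S.
  rewrite /= /ket /wedge (vacuum_sea L) fact0 mul1r.
  set T := [fset c | c in iota 0 L]%fset.
  have pT : perm_eq T (iota 0 L).
    by apply: uniq_perm; rewrite ?iota_uniq ?fset_uniq // => c; rewrite !inE.
  have cardT : #|` T| = L by rewrite (perm_size pT) size_iota.
  have ST : (#|` S| == L) && (particles L S == 0%N) = (S == T).
    apply/andP/eqP => [[/eqP cS]|->]; last first.
      rewrite cardT eqxx; split => //; rewrite /particles -leqn0 leqNgt -has_count.
      by apply/hasPn => c; rewrite !inE /= mem_iota -ltnNge.
    rewrite /particles -leqn0 leqNgt -has_count => /hasPn nS.
    apply/eqP; rewrite eqEfcard cS cardT leqnn andbT; apply/fsubsetP => c /nS.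
    by rewrite !inE /= mem_iota -ltnNge.
  rewrite ST; case: (eqVneq S T) => [->|/eqP nST]; last first.
    by rewrite (introF eqP (fun e => nST (sea_inj e))).
  rewrite eqxx (sea_coef_perm _ pT) /sea_coef subrr (mulr0 (3 * _)) qp0 mul1r.
  rewrite -(weight_perm _ (levels0_perm L)).
  by rewrite (weight_levels0 (qp_neq0 R 6) (@sqrtq_aperiodic R)).
rewrite iterS bilinear_sea.
have step x b : x \in S -> (L <= x)%N -> (b < L)%N -> b \notin (S `\ x)%fset ->
    (#|` (b |` (S `\ x))%fset| = #|` S|) /\
    (particles L S = (particles L (b |` (S `\ x))%fset).+1).
  move=> xS Lx bL bD; split; first by rewrite cardfsU1 bD (cardfsD1 x S) xS.
  have pS : perm_eq S (x :: (S `\ x)%fset).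
    by rewrite -{1}(fsetD1K xS) perm_fsetU1 // !inE eqxx.
  have pT : perm_eq (b |` (S `\ x))%fset (b :: (S `\ x)%fset).
    exact: perm_fsetU1.
  by rewrite /particles (seq.permP pS) (seq.permP pT) /= Lx leqNgt bL.
have [/andP[/eqP cS /eqP pS]|nS] := boolP ((#|` S| == L) && (particles L S == k.+1)).
  have inner x : x \in S -> (L <= x)%N -> \sum_(b <- iota 0 L | b \notin (S `\ x)%fset)
      Acoef R a (x - L) (L - b.+1) *
      (above_sign K x (S `\ x)%fset * above_sign K b (S `\ x)%fset) *
      iter k (bilinear_op (Acoef R a)) (ket K part0) (sea L (b |` (S `\ x))%fset)
    = k`!%:R * sea_coef L S.
    move=> xS Lx; have xD : x \notin (S `\ x)%fset by rewrite !inE eqxx.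
    have -> : sea_coef L S = sea_coef L (x :: (S `\ x)%fset).
      by apply: sea_coef_perm; rewrite -{1}(fsetD1K xS) perm_fsetU1.
    rewrite -sea_coef_expansion //; last by rewrite -cS (cardfsD1 x S) xS.
    rewrite mulr_sumr !(big_seq_cond (fun b => b \notin _)).
    apply: eq_bigr => b /andP[]; rewrite mem_iota /= => bL bD.
    have [cT pT] := step x b xS Lx bL bD.
    move: pT; rewrite pS IH cT cS eqxx => -[<-]; rewrite eqxx /=.
    by rewrite (sea_coef_perm _ (perm_fsetU1 bD)) mulrCA.
  rewrite big_seq_cond (eq_bigr (fun=> k`!%:R * sea_coef L S)); last first.
    by move=> x /andP[xS Lx]; exact: inner.
  rewrite -big_seq_cond big_const_seq -/(particles L S) pS.
  by rewrite iter_addr addr0 factS natrM -mulrA [RHS]mulr_natl.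
rewrite big_seq_cond big1 // => x /andP[xS Lx]; rewrite big_seq_cond big1 // => b /andP[].
rewrite mem_iota /= => bL bD; have [cT pT] := step x b xS Lx bL bD.
rewrite IH cT ifN ?mulr0 //; apply: contra nS => /andP[-> /eqP E] /=.
by rewrite pT E.
Qed.

Lemma exp_bilinear L (S : {fset nat}) :
  exp_op (bilinear_op (Acoef R a)) (ket K part0) (sea L S) =
  if #|` S| == L then sea_coef L S else 0.
Proof.
rewrite /exp_op (fsbigTE [fset particles L S]%fset) => [|k]; last first.
  by rewrite inE iter_bilinear eq_sym andbC => /negPf ->; rewrite mulr0.
rewrite big_seq_fset1 iter_bilinear eqxx andbT; case: ifP => _; last by rewrite mulr0.
rewrite mulrA mulVf ?mul1r //; have := fact_gt0 (particles L S).
by case: (_`!) => // n _; exact: scalars_char0.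
Qed.

End Exponential.

(** * Wedges of charge zero and partitions *)

Definition level_set (mu : part) (L : nat) : {fset nat} := [fset c in levels mu L]%fset.

Lemma level_setE mu L c : (c \in level_set mu L) = (c \in levels mu L).
Proof. by rewrite !inE. Qed.

Lemma perm_level_set mu L : perm_eq (level_set mu L) (levels mu L).
Proof. by apply: uniq_perm; rewrite ?fset_uniq ?levels_uniq // => c; rewrite level_setE. Qed.

Lemma card_level_set mu L : #|` level_set mu L| = L.
Proof. by rewrite (perm_size (perm_level_set mu L)) size_mkseq. Qed.

Lemma maya_sea (mu : part) L : (size mu <= L)%N -> maya mu = sea L (level_set mu L).
Proof.
move=> muL; apply: adm_ext => r; rewrite /= /maya_set /sea_set /= level_setE; split.
  move=> [i _ <-]; case: (ltnP i L) => iL.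
    apply/orP; right; apply/mapP; exists i; first by rewrite mem_iota.
    by rewrite /level; lia.
  by rewrite nth_default ?(leq_trans muL) //; apply/orP; left; lia.
case: (ltrP r (- L%:Z)) => rL.
  move=> _; exists (absz r).-1 => //; rewrite nth_default; lia.
case/mapP => i; rewrite mem_iota /level /= => iL E; exists i => //; lia.
Qed.

(** The position - size mu is vacant in the Maya diagram of a nonempty mu. *)
Lemma maya_sea_size (mu : part) L S : maya mu = sea L S -> (size mu <= L)%N.
Proof.
move=> E; rewrite leqNgt; apply/negP => Lmu.
have : maya_set mu (- (size mu)%:Z).
  have : adm_set (maya mu) (- (size mu)%:Z) by rewrite E; apply/orP; left; lia.
  by [].
case=> i _; case: (ltnP i (size mu)) => [imu|mui]; last by rewrite nth_default //; lia.
by have := part_nth_gt0 mu i; rewrite imu; lia.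
Qed.

Lemma maya_inj : injective maya.
Proof.
move=> mu nu E; pose L := maxn (size mu) (size nu).
move: E; rewrite !(@maya_sea _ L) ?leq_maxl ?leq_maxr // => /sea_inj E.
have {}E : levels mu L = levels nu L.
  apply: (irr_sorted_eq (leT := gtn)); rewrite ?levels_sorted //.
  - by move=> x y z /= yx zy; exact: ltn_trans zy yx.
  - by move=> x /=; rewrite ltnn.
  - by move=> c; rewrite -!level_setE E.
apply: part_ext => i; case: (ltnP i L) => iL.
  by have := congr1 (fun s => nth 0%N s i) E; rewrite !nth_mkseq // => /addIn.
by rewrite !nth_default // (leq_trans _ iL) ?leq_maxl ?leq_maxr.
Qed.

(** In a nonincreasing sequence the zeros come last. *)
Lemma nth_filter_pos (s : seq nat) i :
  sorted geq s -> nth 0%N (filter (leq 1) s) i = nth 0%N s i.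
Proof.
elim: s i => [|x s IH] i //= xs.
have tr : transitive geq by move=> a b c /= ba cb; exact: leq_trans cb ba.
case: x xs => [|x] xs /=; last by case: i => //= i; rewrite IH // (path_sorted xs).
have s0 : forall y, y \in s -> y = 0%N.
  move=> y ys; move: xs; rewrite path_sortedE // => /andP[/allP/(_ _ ys)] /=.
  by rewrite leqn0 => /eqP.
have -> : filter (leq 1) s = [::].
  by apply/eqP; rewrite -size_eq0 size_filter -leqn0 leqNgt -has_count;
     apply/hasPn => y /s0 ->.
rewrite nth_nil; case: i => //= i; case: (ltnP i (size s)) => [lt|ge].
  by rewrite (s0 _ (mem_nth 0%N lt)).
by rewrite nth_default.
Qed.

(** A decreasing sequence of L distinct naturals dominates L - 1, ..., 1, 0 and
    the differences are nonincreasing. *)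
Lemma level_set_surj (L : nat) (S : {fset nat}) : #|` S| = L ->
  exists2 mu : part, (size mu <= L)%N & level_set mu L = S.
Proof.
move=> cS; pose t := sort geq S.
have tS : perm_eq t S by rewrite perm_sort.
have st : size t = L by rewrite (perm_size tS).
have tt i : (i.+1 < L)%N -> (nth 0 t i.+1 < nth 0 t i)%N.
  move=> iL; have geqT : total geq by move=> x y; exact: leq_total.
  have /(sortedP 0%N)/(_ i) : sorted geq t by apply: sort_sorted.
  rewrite st => /(_ iL) /=; rewrite leq_eqVlt => /orP[|//].
  by rewrite nth_uniq ?st ?(ltnW iL) // ?(perm_uniq tS) ?fset_uniq // => /eqP; lia.
(* the i-th largest element of S is at least its smallest possible value L - i - 1 *)
have tge k i : (i + k.+1 = L -> k <= nth 0 t i)%N.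
  elim: k i => // k IH i E; have := IH i.+1; have := tt i; lia.
pose m := mkseq (fun i => nth 0 t i - (L - i.+1))%N L.
have sm : sorted geq m.
  apply/(sortedP 0%N) => i; rewrite size_mkseq => iL; rewrite !nth_mkseq ?(ltnW iL) //=.
  by have := tt i iL; lia.
have pm : is_part (filter (leq 1) m).
  apply/andP; split; last by rewrite mem_filter.
  by apply: sorted_filter sm => a b c /= ba cb; exact: leq_trans cb ba.
exists (Part pm).
  by rewrite /= size_filter (leq_trans (count_size _ _)) // size_mkseq.
have -> : S = [fset c in t]%fset by apply/fsetP => c; rewrite !inE (perm_mem tS).
rewrite /level_set (_ : levels _ L = t) //.
apply: (@eq_from_nth _ 0%N); rewrite size_mkseq // => i iL.
by rewrite nth_mkseq // /level nth_filter_pos // nth_mkseq // subnK // tge //; lia.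
Qed.

Lemma energy_levels (mu : part) L : (size mu <= L)%N ->
  energy L (levels mu L) - energy L (iota 0 L) = kappa mu.
Proof.
move=> muL; rewrite /energy -(perm_big _ (levels0_perm L)) /= !big_levels -sumrB /kappa.
pose f i := (nth 0%N mu i)%:Z * ((nth 0%N mu i)%:Z - 2 * i.+1%:Z + 1).
rewrite (big_ord_widen L f muL) [RHS]big_mkcond; apply: eq_bigr => i _ /=.
have lE (nu : part) : (level nu L i)%:Z = (nth 0%N nu i)%:Z + L%:Z - i%:Z - 1.
  by rewrite /level; have := ltn_ord i; lia.
rewrite !lE nth_nil; case: ifPn => im; first by rewrite /f; ring.
have -> : nth 0%N mu i = 0%N by apply: nth_default; rewrite leqNgt.
exact: subrr.
Qed.

Lemma framed_vertex_sea (R : realType) a (mu : part) L : (size mu <= L)%N ->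
  framed_vertex R a 0 0 mu part0 part0 = sea_coef R a L (level_set mu L).
Proof.
move=> muL; rewrite (sea_coef_perm _ _ _ (perm_level_set mu L)) framed_vertex_one_leg.
by rewrite /sea_coef energy_levels // (weight_levels (qp_neq0 R 6) (@sqrtq_aperiodic R) muL).
Qed.

Theorem theorem4p2 (R : realType) (a : int) :
  (fun B : admissible =>
     \sum_(mu \in [set: part])
        framed_vertex R a 0 0 mu part0 part0 * ket (scalars R) mu B)
  = exp_op (bilinear_op (Acoef R a)) (ket (scalars R) part0).
Proof.
apply/funext => B; have [L [S ->]] := seaP B; rewrite exp_bilinear.
case: eqP => [/level_set_surj[mu muL <-]|cS].
  rewrite -(framed_vertex_sea _ _ muL) -(maya_sea muL).
  rewrite (fsbigTE [fset mu]%fset) => [|nu]; last first.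
    rewrite inE /ket /wedge eq_sym => /eqP munu.
    by case: eqP => [/maya_inj//|_]; rewrite mulr0.
  by rewrite big_seq_fset1 /ket /wedge eqxx mulr1.
apply: fsbig1 => mu _; rewrite /ket /wedge; case: eqP => [E|_]; last by rewrite mulr0.
case: cS; have muL := maya_sea_size (esym E).
by move: E; rewrite (maya_sea muL) => /sea_inj ->; exact: card_level_set.
Qed.
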